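(* Consider the token swapping problem on a connected graph $G$ with $n$ vertices and $m$ edges. Let $k$ denote the minimum number of swaps needed to bring every token to its target vertex, and let $\Delta$ denote the maximum degree of $G$. An optimal (shortest) sequence of swaps can be found within each of the following running times: (1) $O(n!\, m n\log n)=2^{O(n\log n)}$; (2) $O(m^{k} n\log n)=O(n^{2k+1}\log n)$; (3) $(2k\Delta)^{k}\cdot O(n\log n)$. Moreover, in each case the space requirement of the algorithm is equal to the corresponding running time bound divided by $n\log n$.
   Context: Token swapping problem: we are given a connected undirected graph $G$ with vertices $v_1,\dots,v_n$; each vertex $v_i$ initially holds exactly one token $T_{\pi(i)}$, where $\pi$ is a permutation of $\{1,\dots,n\}$. A swap exchanges the tokens on the two endpoints of an edge of $G$ (all other tokens stay in place). The goal is to find a shortest sequence of swaps after which every vertex $v_i$ holds token $T_i$ (such a sequence always exists). *)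

(* Defs.v *)
From mathcomp Require Import all_boot perm fingroup.
Set Implicit Arguments.
Unset Strict Implicit.
Unset Printing Implicit Defensive.

(* Instances of token swapping.  Vertices and tokens are numbered from 0; a
   configuration c sends a vertex to the token that it holds. *)
Record instance := Instance {
  num_vertices : nat;
  adjacent : rel 'I_num_vertices;
  initial : {perm 'I_num_vertices};
  num_vertices_gt0 : 0 < num_vertices;
  adjacent_sym : symmetric adjacent;
  adjacent_irr : irreflexive adjacent;
  adjacent_conn : forall u v, connect adjacent u v }.

Definition num_edges (I : instance) : nat :=
  #|[set uv : 'I_(num_vertices I) * 'I_(num_vertices I) |
      (uv.1 < uv.2) && adjacent uv.1 uv.2]|.

Definition max_degree (I : instance) : nat :=
  \max_(v < num_vertices I) #|[set u | adjacent v u]|.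

(* Products of permutations compose from left to right, hence
   swap c (u, v) x = c (tperm u v x). *)
Definition swap n (c : {perm 'I_n}) (uv : 'I_n * 'I_n) : {perm 'I_n} :=
  (tperm uv.1 uv.2 * c)%g.

Definition solves (I : instance) (s : seq ('I_(num_vertices I) * 'I_(num_vertices I))) :=
  all (fun uv => adjacent uv.1 uv.2) s &&
  [forall v, foldl (@swap _) (initial I) s v == v].

Definition optimal (I : instance) (s : seq ('I_(num_vertices I) * 'I_(num_vertices I))) :=
  solves s /\ forall s', @solves I s' -> size s <= size s'.

Definition solvable_in (I : instance) (k : nat) : bool :=
  [exists s : k.-tuple ('I_(num_vertices I) * 'I_(num_vertices I)), @solves I s].

Lemma solvable (I : instance) : exists k, solvable_in I k.
Proof.
case: I => n e pi n_gt0 e_sym e_irr e_conn.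
pose A := [set tperm uv.1 uv.2 | uv in [pred uv : 'I_n * 'I_n | e uv.1 uv.2]].
have tA u v : tperm u v \in <<A>>%g.
  case/connectP: (e_conn u v) => p; elim: p u => [|w p IHp] u /= => [_ -> | ].
    by rewrite tperm1 group1.
  case/andP=> euw pwp lastv; have tuw : tperm u w \in <<A>>%g.
    by apply/mem_gen/imsetP; exists (u, w).
  have twv := IHp w pwp lastv.
  have [-> | neq_uv] := eqVneq u v; first by rewrite tperm1 group1.
  have [<- // | neq_wv] := eqVneq w v.
  have -> : tperm u v = (tperm u w ^ tperm w v)%g.
    by rewrite tpermJ tpermL tpermD // 1?eq_sym // eq_sym;
       apply: contraTneq euw => ->; rewrite e_irr.
  by rewrite groupJ.
have : (pi^-1)%g \in <<A>>%g.
  have [ts -> _] := prod_tpermP (pi^-1)%g.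
  by apply: group_prod => t _; apply: tA.
case/gen_prodgP=> k [f Af Ef].
have /fin_all_exists[g gP] i : exists uv : 'I_n * 'I_n,
    e uv.1 uv.2 /\ f i = tperm uv.1 uv.2.
  by have /imsetP[uv euv ->] := Af i; exists uv.
pose s := rev [seq g i | i <- index_enum 'I_k].
exists (size s); apply/existsP; exists (in_tuple s); rewrite /solves /=.
apply/andP; split.
  rewrite all_rev; apply/allP => _ /mapP[i _ ->]; by case: (gP i).
have -> : foldl (@swap _) pi s = 1%g.
  apply: (mulIg (pi^-1)%g); rewrite mul1g {2}Ef /s.
  rewrite foldl_rev foldr_map.
  elim: (index_enum _) => [|i r IHr] /=; first by rewrite big_nil mulgV.
  by rewrite big_cons /swap -mulgA IHr; case: (gP i) => _ ->.
by apply/forallP => v; rewrite perm1.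
Qed.

Definition min_swaps (I : instance) : nat := ex_minn (solvable I).

(* Word RAM.  Programs are while programs over registers (Reg x), a read-only
   input array (Input a) and a work memory (Work a), both randomly accessed,
   and a write-only output.  An operation whose result does not fit in a word, and
   an access outside the available input or work cells, have no semantics. *)
Inductive binop := Plus | Minus | Times | Quot | Rem | IsEq | IsLt.

Inductive expr :=
  | Lit of nat
  | Reg of nat
  | Input of expr
  | Work of expr
  | Op of binop & expr & expr.

Inductive cmd :=
  | Skip
  | Assign of nat & expr
  | Store of expr & expr
  | Emit of expr
  | Seq of cmd & cmd
  | If of expr & cmd & cmd
  | While of expr & cmd.

Definition apply_op (o : binop) (i j : nat) : nat :=
  match o with
  | Plus => i + j
  | Minus => i - j
  | Times => i * j
  | Quot => i %/ j
  | Rem => i %% j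
  | IsEq => i == j
  | IsLt => i < j
  end.

Record state := State {
  regs : nat -> nat;
  work : nat -> nat;
  output : seq nat }.

Definition update (f : nat -> nat) (i v : nat) : nat -> nat :=
  fun j => if j == i then v else f j.

Fixpoint eval (W space : nat) (inp : seq nat) (st : state) (e : expr) :
    option nat :=
  match e with
  | Lit i => if i < W then Some i else None
  | Reg x => Some (regs st x)
  | Input a => obind (fun i => if i < size inp then Some (nth 0 inp i) else None)
                  (eval W space inp st a)
  | Work a => obind (fun i => if i < space then Some (work st i) else None)
                   (eval W space inp st a)
  | Op o a b =>
      obind (fun i => obind (fun j =>
               if apply_op o i j < W then Some (apply_op o i j) else None)
               (eval W space inp st b))
            (eval W space inp st a)
  end.

Fixpoint cost (e : expr) : nat :=
  match e with
  | Lit _ | Reg _ => 1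
  | Input a | Work a => (cost a).+1
  | Op _ a b => (cost a + cost b).+1
  end.

(* exec W space inp P st t st': with words in [0, W), work cells
   0, ..., space - 1 and input inp, the program P leads from st to st' in time
   t, every elementary operation having unit cost. *)
Inductive exec (W space : nat) (inp : seq nat) :
    cmd -> state -> nat -> state -> Prop :=
  | ExecSkip st : exec W space inp Skip st 1 st
  | ExecAssign st x e i :
      eval W space inp st e = Some i ->
      exec W space inp (Assign x e) st (cost e).+1
        (State (update (regs st) x i) (work st) (output st))
  | ExecStore st a e i j :
      eval W space inp st a = Some i -> i < space ->
      eval W space inp st e = Some j ->
      exec W space inp (Store a e) st (cost a + cost e).+1
        (State (regs st) (update (work st) i j) (output st))
  | ExecEmit st e i :
      eval W space inp st e = Some i ->
      exec W space inp (Emit e) st (cost e).+1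
        (State (regs st) (work st) (rcons (output st) i))
  | ExecSeq P Q st1 st2 st3 t1 t2 :
      exec W space inp P st1 t1 st2 -> exec W space inp Q st2 t2 st3 ->
      exec W space inp (Seq P Q) st1 (t1 + t2) st3
  | ExecIf e P Q st st' i t :
      eval W space inp st e = Some i ->
      exec W space inp (if i != 0 then P else Q) st t st' ->
      exec W space inp (If e P Q) st (cost e + t).+1 st'
  | ExecWhileStop e P st :
      eval W space inp st e = Some 0 ->
      exec W space inp (While e P) st (cost e).+1 st
  | ExecWhileStep e P st1 st2 st3 i t1 t2 :
      eval W space inp st1 e = Some i -> i != 0 ->
      exec W space inp P st1 t1 st2 ->
      exec W space inp (While e P) st2 t2 st3 ->
      exec W space inp (While e P) st1 (cost e + t1 + t2).+1 st3.

Definition start : state := State (fun=> 0) (fun=> 0) [::].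

Definition adjacency_lists (I : instance)
    (adj : 'I_(num_vertices I) -> seq 'I_(num_vertices I)) : Prop :=
  forall v, perm_eq (adj v) (enum [set u | adjacent v u]).

(* The input consists of n, the initial tokens of the n vertices, the n + 1
   offsets that delimit the adjacency lists of the vertices in their
   concatenation, and this concatenation. *)
Definition encode (I : instance) (adj : 'I_(num_vertices I) -> seq 'I_(num_vertices I)) :
    seq nat :=
  num_vertices I ::
    [seq val (initial I v) | v <- enum 'I_(num_vertices I)] ++
    [seq \sum_(v < num_vertices I | v < i) size (adj v) | i <- iota 0 (num_vertices I).+1] ++
    [seq val u | u <- flatten [seq adj v | v <- enum 'I_(num_vertices I)]].

Definition encode_swaps n (s : seq ('I_n * 'I_n)) : seq nat :=
  flatten [seq [:: val uv.1; val uv.2] | uv <- s].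

Definition log2 (n : nat) : nat := trunc_log 2 n.

(* One fixed program finds an optimal sequence on every instance, in time
   O(time I) and using O(space I) work cells.  The words have
   O(log (input length + number of work cells)) bits.  The bounds of interest
   are positive when there are at least two vertices, so [maxn 1] only matters
   for the graph with one vertex, where log n = 0. *)
Definition optimal_swaps_found_within (time space : instance -> nat) : Prop :=
  exists (P : cmd) (c : nat), forall (I : instance) adj,
  @adjacency_lists I adj ->
  let inp := encode adj in
  let cells := c * maxn 1 (space I) in
  exists (t : nat) (st : state) (s : seq ('I_(num_vertices I) * 'I_(num_vertices I))),
    [/\ exec ((size inp + cells) ^ c) cells inp P start t st,
        t <= c * maxn 1 (time I),
        output st = encode_swaps s &
        optimal s].

(* Main.v *)
(* (2) and (3) use depth-first search with iterative deepening.  A swap whose ends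
   are not misplaced commutes with the configuration, so a sorting sequence that
   starts with it can be rotated; hence some optimal sequence starts with a swap
   that moves a misplaced token.  When r swaps are left, at most 2r vertices are
   misplaced, so at most min(m, 2 r Delta) swaps have to be tried.  This gives
   O(m^k) nodes, resp. O((2 Delta)^k k!) nodes.  As k! k <= k^k, in (3) there is
   time to recompute a token from the stack of swaps whenever it is needed, so that
   O(k) cells suffice.

   (1) uses breadth-first search over all configurations, from the identity to the
   initial one, so that the parent links spell out the swaps in order.  The queue
   stores a configuration in n <= 2m cells, and visited configurations are
   recognized by a rank below n! that is computed in time O(n). *)

(* The space bounds shape the searches. Divided by n log n, they leave m^k cells in (2) and (2k
   Delta)^k cells in (3). A token array fits in (2) because n <= 2m <= 2m^k as soon as k > 0. In (3)
   the bound does not grow with n, so only the stack is kept. When k = 0 both leave constantly many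
   cells, and the identity has to be recognised on the input alone. Both searches are instances of
   one program, verified once against abstract commands that look up a token and apply a swap.
   Deepening repeats work at every budget. The repetition costs a constant factor because the bound
   on the number of nodes at least doubles with each further swap; the exception is m = 1, where k
   <= 1. On the unit-cost machine all three searches stay within the bounds without the factor log
   n, which is only used as being at least 1. *)
Require Import Defs.
From mathcomp Require Import all_boot perm fingroup zify.

Set Implicit Arguments.
Unset Strict Implicit.
Unset Printing Implicit Defensive.

(** * Execution with running times *)

(* Convertible to update, but evaluated by cbn on numerals. *)
Definition setr (f : nat -> nat) (i v : nat) : nat -> nat :=
  fun j => if Nat.eqb j i then v else f j.

Arguments setr f !i v !j.

Lemma setr_neq f i v j : j != i -> setr f i v j = f j.
Proof. by rewrite /setr -[Nat.eqb j i]/(j == i) => /negPf->. Qed.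

Lemma setr_lt f i v j : j < i -> setr f i v j = f j.
Proof. by move=> lt_ji; rewrite setr_neq // ltn_eqF. Qed.

Section Logic.

Variables (W space : nat) (inp : seq nat).

Local Notation exec := (exec W space inp).

(** Weakest precondition of evaluation. It computes on a concrete expression to one side condition
    per literal, memory access and operation, which linear arithmetic can discharge. *)
Fixpoint ev (e : expr) (st : state) (Q : nat -> Prop) : Prop :=
  match e with
  | Lit i => i < W /\ Q i
  | Reg x => Q (regs st x)
  | Input a => ev a st (fun i => i < size inp /\ Q (nth 0 inp i))
  | Work a => ev a st (fun i => i < space /\ Q (work st i))
  | Op o a b => ev a st (fun i => ev b st (fun j =>
      apply_op o i j < W /\ Q (apply_op o i j)))
  end.

Lemma evP e st Q : ev e st Q -> exists2 i, eval W space inp st e = Some i & Q i.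
Proof.
elim: e Q => [i|x|a IHa|a IHa|o a IHa b IHb] Q /=.
- by case=> -> Qi; exists i.
- by move=> Qx; exists (regs st x).
- by case/IHa=> i -> [lti Qi] /=; rewrite lti; exists (nth 0 inp i).
- by case/IHa=> i -> [lti Qi] /=; rewrite lti; exists (work st i).
- case/IHa=> i -> /IHb[j -> [ltW Q'ij]] /=; rewrite ltW.
  by exists (apply_op o i j).
Qed.

Lemma ev_mono e st (Q Q' : nat -> Prop) :
  (forall i, Q i -> Q' i) -> ev e st Q -> ev e st Q'.
Proof.
elim: e Q Q' => [i|x|a IHa|a IHa|o a IHa b IHb] Q Q' QQ' /=.
- by case=> ltiW /QQ'.
- exact: QQ'.
- by apply: IHa => i [ltiW /QQ'].
- by apply: IHa => i [ltiW /QQ'].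
- by apply: IHa => i; apply: IHb => j [ltW /QQ'].
Qed.

(** Derivations of [exec] are finite, so this is total correctness; the postcondition also sees the
    running time. *)
Definition wp (P : cmd) (st : state) (Q : nat -> state -> Prop) : Prop :=
  exists t st', exec P st t st' /\ Q t st'.

Lemma wp_mono P st (Q Q' : nat -> state -> Prop) :
  wp P st Q -> (forall t st', Q t st' -> Q' t st') -> wp P st Q'.
Proof. by case=> t [st' [Pst Qst]] QQ'; exists t, st'; split=> //; apply: QQ'. Qed.

Lemma wp_skip st (Q : nat -> state -> Prop) : Q 1 st -> wp Skip st Q.
Proof. by exists 1, st; split=> //; constructor. Qed.

Lemma wp_assign x e st Q :
  ev e st (fun i => Q (cost e).+1
                      (State (setr (regs st) x i) (work st) (output st))) ->
  wp (Assign x e) st Q.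
Proof.
by case/evP=> i ei Qi; do 2!eexists; split; [apply: ExecAssign ei | apply: Qi].
Qed.

Lemma wp_store a e st (Q : nat -> state -> Prop) :
  ev a st (fun i => i < space /\ ev e st (fun j => Q (cost a + cost e).+1
                      (State (regs st) (update (work st) i j) (output st)))) ->
  wp (Store a e) st Q.
Proof.
case/evP=> i ai [lti /evP[j ej Qj]]; do 2!eexists; split; last exact: Qj.
exact: ExecStore ai lti ej.
Qed.

Lemma wp_emit e st Q :
  ev e st (fun i => Q (cost e).+1
                      (State (regs st) (work st) (rcons (output st) i))) ->
  wp (Emit e) st Q.
Proof.
by case/evP=> i ei Qi; do 2!eexists; split; [apply: ExecEmit ei | apply: Qi].
Qed.

Lemma wp_seq P P' st (Q : nat -> state -> Prop) :
  wp P st (fun t st1 => wp P' st1 (fun t' st2 => Q (t + t') st2)) ->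
  wp (Seq P P') st Q.
Proof.
case=> t [st1 [Pst1 [t' [st2 [Pst2 Q2]]]]].
by exists (t + t'), st2; split=> //; apply: ExecSeq Pst1 Pst2.
Qed.

Lemma wp_if e P P' st (Q : nat -> state -> Prop) :
  ev e st (fun i => (0 < i -> wp P st (fun t => Q (cost e + t).+1)) /\
                    (i = 0 -> wp P' st (fun t => Q (cost e + t).+1))) ->
  wp (If e P P') st Q.
Proof.
case/evP=> i ei [Qthen Qelse].
have [i0|i_gt0] := posnP i.
  have [t [st' [Pst Qt]]] := Qelse i0.
  by exists (cost e + t).+1, st'; split=> //; apply: ExecIf ei _; rewrite i0.
have [t [st' [Pst Qt]]] := Qthen i_gt0.
exists (cost e + t).+1, st'; split=> //; apply: ExecIf ei _.
by rewrite -lt0n i_gt0.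
Qed.

(** The index of [I] is fuel: each iteration consumes one unit, and the loop may stop with some
    left. [R] records what holds on exit whatever the index. *)
Lemma wp_while (I : nat -> state -> Prop) (R : state -> Prop) B k e P st
    (Q : nat -> state -> Prop) :
  (forall i st, I i st -> ev e st (fun x =>
     (x = 0 -> R st) /\
     (0 < x -> exists2 j, i = j.+1 & wp P st (fun t st' => t <= B /\ I j st')))) ->
  I k st ->
  (forall t st', t <= k * (cost e + B).+1 + (cost e).+1 -> R st' -> Q t st') ->
  wp (While e P) st Q.
Proof.
move=> Istep; elim: k st Q => [|k IHk] st Q Ik Qend.
  case/Istep/evP: (Ik) => x ex [x0 x1]; have [xE|/x1[j] //] := posnP x.
  exists (cost e).+1, st; split; first by apply: ExecWhileStop; rewrite ex xE.
  by apply: Qend => //; apply: x0.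
case/Istep/evP: (Ik) => x ex [x0 x1]; have [xE|x_gt0] := posnP x.
  exists (cost e).+1, st; split; first by apply: ExecWhileStop; rewrite ex xE.
  by apply: Qend => //; [rewrite leq_addl | apply: x0].
have [j [<-] [t [st1 [Pst [leB Ij]]]]] := x1 x_gt0.
have [|t' [st2 [Pst2 Q2]]] :=
  IHk st1 (fun t' st2 => Q (cost e + t + t').+1 st2) Ij.
  move=> t' st2 le_t' R2; apply: Qend => //; rewrite mulSn; lia.
exists (cost e + t + t').+1, st2; split=> //.
by apply: ExecWhileStep ex _ Pst Pst2; rewrite -lt0n.
Qed.

Lemma wp_for (J : nat -> state -> Prop) n B e P st (Q : nat -> state -> Prop) :
  (forall i st, J i st -> i < n -> ev e st (fun x => 0 < x) /\
     wp P st (fun t st' => t <= B /\ J i.+1 st')) ->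
  (forall st, J n st -> ev e st (fun x => x = 0)) ->
  J 0 st ->
  (forall t st', t <= n * (cost e + B).+1 + (cost e).+1 -> J n st' -> Q t st') ->
  wp (While e P) st Q.
Proof.
move=> Jstep Jstop J0 Jend.
apply: (@wp_while (fun i st => i <= n /\ J (n - i) st) (J n) B n) => //.
- move=> i st' [le_in Ji]; case: i => [|i] in le_in Ji *.
    rewrite subn0 in Ji.
    by apply: ev_mono (Jstop _ Ji) => x ->.
  have [ev_pos wpP] := Jstep _ _ Ji ltac:(lia).
  apply: ev_mono ev_pos => x x_gt0; split=> [xE|_]; first by rewrite xE in x_gt0.
  exists i => //.
  apply: wp_mono wpP _ => t st2 [leB J2]; split=> //.
  by split; [exact: ltnW|move: J2; rewrite -subSn // subSS].
- by rewrite subnn.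
Qed.

(** Matches the goal that [wp_if] leaves when the test is a comparison. *)
Lemma bool_cases (b : bool) (P P' : Prop) :
  (b -> P) -> (~~ b -> P') -> (0 < b -> P) /\ (b = 0 :> nat -> P').
Proof. by case: b => PP PP'; split=> // _; auto. Qed.

(* The loop runs from st through some state satisfying Q; the rest of its
   execution is left open, so that segments of one loop can be composed. *)
Definition reaches e P st T (Q : state -> Prop) : Prop :=
  exists t st', [/\ t <= T, Q st' & forall t' st2,
    exec (While e P) st' t' st2 -> exec (While e P) st (t + t') st2].

Lemma reaches_refl e P st T (Q : state -> Prop) : Q st -> reaches e P st T Q.
Proof. by move=> Qst; exists 0, st. Qed.

Lemma reaches_step e P st B T (Q : state -> Prop) :
  ev e st (fun x => 0 < x) ->
  wp P st (fun t st' => t <= B /\ reaches e P st' T Q) ->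
  reaches e P st ((cost e + B).+1 + T) Q.
Proof.
case/evP=> x ex x_gt0 [t1 [st1 [Pst [leB [t2 [st2 [leT Q2 run]]]]]]].
exists ((cost e + t1).+1 + t2), st2; split=> //; first lia.
move=> t' st3 /run run1; rewrite !addSn -(addnA (cost e + t1)).
by apply: ExecWhileStep ex _ Pst run1; rewrite -lt0n.
Qed.

Lemma reaches_trans e P st T1 T2 (Q1 Q2 : state -> Prop) :
  reaches e P st T1 Q1 -> (forall st', Q1 st' -> reaches e P st' T2 Q2) ->
  reaches e P st (T1 + T2) Q2.
Proof.
case=> t1 [st1 [le1 Q1st run1]] /(_ _ Q1st)[t2 [st2 [le2 Q2st run2]]].
exists (t1 + t2), st2; split=> //; first exact: leq_add.
by move=> t' st3 /run2/run1; rewrite addnA.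
Qed.

Lemma reaches_mono e P st T T' (Q Q' : state -> Prop) :
  reaches e P st T Q -> T <= T' -> (forall st', Q st' -> Q' st') ->
  reaches e P st T' Q'.
Proof.
case=> t [st' [leT Qst run]] leTT' QQ'; exists t, st'; split=> //.
  exact: leq_trans leTT'.
exact: QQ'.
Qed.

Lemma reaches_le e P st T T' (Q : state -> Prop) :
  T <= T' -> reaches e P st T Q -> reaches e P st T' Q.
Proof. by move=> leTT' /reaches_mono; apply. Qed.

Lemma wp_reaches e P st T R (Q : nat -> state -> Prop) :
  reaches e P st T R ->
  (forall st', R st' -> ev e st' (fun x => x = 0)) ->
  (forall t st', t <= T + (cost e).+1 -> R st' -> Q t st') ->
  wp (While e P) st Q.
Proof.
case=> t [st' [leT Rst run]] Rstop RQ.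
have [x ex x0] := evP (Rstop _ Rst).
exists (t + (cost e).+1), st'; split; last by apply: RQ => //; rewrite leq_add2r.
by apply/run/ExecWhileStop; rewrite ex x0.
Qed.

End Logic.

Ltac wsimp := cbn [ev cost regs work output setr Nat.eqb apply_op].

(** * Swap sequences *)

Section Words.

Variable I : instance.
Local Notation n := (num_vertices I).
Local Notation word := (seq ('I_n * 'I_n)).
Local Notation config := {perm 'I_n}.
Local Notation adj2 := (fun uv : 'I_n * 'I_n => adjacent uv.1 uv.2).
Local Open Scope group_scope.

Implicit Types (c : config) (s : word) (t : 'I_n * 'I_n).

Definition play (c : config) (s : word) : config := foldl (@swap n) c s.

Definition sorts (c : config) (s : word) : bool := all adj2 s && (play c s == 1).

Definition misplaced (c : config) : {set 'I_n} := [set v | c v != v].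

Lemma play_rcons c s t : play c (rcons s t) = swap (play c s) t.
Proof. exact: foldl_rcons. Qed.

(** Swaps multiply on the left, so a sequence contributes the same left factor whatever
    configuration it starts from. *)
Lemma playM c s : play c s = play 1 s * c.
Proof.
elim/last_ind: s => [|s t IHs]; first by rewrite /play /= mul1g.
by rewrite !play_rcons /swap IHs mulgA.
Qed.

Lemma swapK c t : swap (swap c t) t = c.
Proof. by rewrite /swap mulgA tperm2 mul1g. Qed.

Lemma solvesE s : solves s = sorts (initial I) s.
Proof.
congr (_ && _); apply/forallP/eqP => [c1|c1 v]; last by rewrite -/(play _ _) c1 perm1.
by apply/permP => v; rewrite perm1; apply/eqP/c1.
Qed.

Lemma swap_sym c u v : swap c (u, v) = swap c (v, u).
Proof. by rewrite /swap tpermC. Qed.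

Lemma misplaced1P c : reflect (c = 1) (misplaced c == set0).
Proof.
apply: (iffP eqP) => [c0|->]; last by apply/setP => v; rewrite !inE perm1 eqxx.
apply/permP => v; rewrite perm1; apply/eqP.
by have := in_set0 v; rewrite -c0 inE => /negbFE.
Qed.

(** A swap affects only its two ends, so it lowers the number of misplaced vertices by at most
    two. *)
Lemma card_misplaced_sorts c s : sorts c s -> #|misplaced c| <= 2 * size s.
Proof.
elim: s c => [|t s IHs] c /andP[/= adj_s /eqP c_s].
  by have /eqP-> : misplaced c == set0; [apply/misplaced1P | rewrite cards0].
have sub : misplaced c \subset t.1 |: (t.2 |: misplaced (swap c t)).
  apply/subsetP => v; rewrite !inE /swap permM.
  by case: tpermP => [->|->|_ _ ->]; rewrite ?eqxx ?orbT.
apply: leq_trans (subset_leq_card sub) _.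
have : sorts (swap c t) s.
  by case/andP: adj_s => _ adj_s; rewrite /sorts adj_s; apply/eqP.
move/IHs; rewrite !cardsU1; lia.
Qed.

Lemma play_disjoint c s v :
  all (fun t => [&& v != t.1 & v != t.2]) s -> play c s v = c v.
Proof.
elim: s c => [//|t s IHs] c /= /andP[/andP[vt1 vt2] /IHs->].
by rewrite /swap permM tpermD // eq_sym.
Qed.

(* A swap whose ends are not misplaced commutes with the configuration, so it
   can be moved from the beginning of a sorting sequence to its end. *)
Lemma sorts_rotate c t s :
  t.1 \notin misplaced c -> t.2 \notin misplaced c ->
  sorts c (t :: s) -> sorts c (rcons s t).
Proof.
rewrite !inE !negbK => /eqP c1 /eqP c2 /andP[/= /andP[adj_t adj_s] /eqP cs].
rewrite /sorts all_rcons adj_t adj_s play_rcons /=.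
have comm : swap c t = c * tperm t.1 t.2.
  by rewrite /swap conjgC tpermJ c1 c2.
have {}cs : play (swap c t) s = 1 by [].
rewrite playM comm in cs.
have -> : play c s = tperm t.1 t.2.
  by apply: (mulIg (tperm t.1 t.2)); rewrite playM -mulgA cs tperm2.
by rewrite /swap tperm2.
Qed.

Lemma sorts_misplaced_head c s :
  c != 1 -> sorts c s ->
  exists t s', [/\ t.1 \in misplaced c,
    (t.2 \in misplaced c) ==> (t.1 <= t.2), adjacent t.1 t.2,
    size s = (size s').+1 & sorts (swap c t) s'].
Proof.
pose P := fun t : 'I_n * 'I_n => (t.1 \in misplaced c) || (t.2 \in misplaced c).
move=> c_neq1 c_s; have [v v_mis] : exists v, v \in misplaced c.
  by apply/set0Pn; apply: contra c_neq1 => /misplaced1P->.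
have touched : has P s.
  have [//|/hasPn Nhas] := boolP (has P s); case/andP: c_s => _ /eqP c_s.
  have := v_mis; rewrite inE -(@play_disjoint c s v) ?c_s ?perm1 ?eqxx //.
  apply/allP => t /Nhas; rewrite negb_or => /andP[t1 t2].
  by apply/andP; split; [apply: contraNneq t1|apply: contraNneq t2] => <-.
have rot s1 s2 t : ~~ has P s1 -> sorts c (s1 ++ t :: s2) ->
    sorts c (t :: s2 ++ s1).
  elim: s1 s2 => [|x s1 IHs] s2; first by rewrite cats0.
  rewrite /= !negb_or => /andP[/andP[x1 x2] Ns1] /sorts_rotate-/(_ x1 x2).
  by rewrite rcons_cat rcons_cons => /IHs-/(_ Ns1); rewrite cat_rcons.
case/split_find: touched c_s => t s1 s2 Pt Ns1; rewrite cat_rcons => c_s.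
have /andP[/= /andP[adj_t adj_s] c_s'] := rot _ _ _ Ns1 c_s.
have sz : size (s1 ++ t :: s2) = (size (s2 ++ s1)).+1.
  by rewrite !size_cat /= addnS addnC.
(* Both directions of a swap have the same effect; if the given one is not admissible, the reversed
   one is. *)
have [t12|t21] := boolP
    ((t.1 \in misplaced c) && ((t.2 \in misplaced c) ==> (t.1 <= t.2))).
  by case/andP: t12; exists t, (s2 ++ s1); split=> //; apply/andP.
exists (t.2, t.1), (s2 ++ s1); split=> //=; rewrite 1?adjacent_sym //.
- by move: Pt t21; rewrite /P; case: (t.1 \in _); case: (t.2 \in _).
- move: Pt t21; rewrite /P; case: (t.1 \in _); case: (t.2 \in _) => //= _.
  by rewrite -ltnNge => /ltnW.
- by rewrite swap_sym -surjective_pairing; apply/andP.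
Qed.

End Words.

(** * Adjacency lists and their encoding *)

Lemma sum_ltS n (F : 'I_n -> nat) (u : 'I_n) :
  \sum_(v < n | v < u.+1) F v = \sum_(v < n | v < u) F v + F u.
Proof.
rewrite (bigD1 u) //= addnC; congr (_ + _); apply: eq_bigl => v.
by rewrite ltnS [in RHS]ltn_neqAle andbC.
Qed.

Section Arcs.

Variable I : instance.
Local Notation n := (num_vertices I).
Variable adj : 'I_n -> seq 'I_n.
Hypothesis adjP : adjacency_lists adj.

(** Same order as the concatenated lists of the input, so that a position there names an arc. An
    edge occurs once in each direction. *)
Definition arcs : seq ('I_n * 'I_n) := [seq (u, v) | u <- enum 'I_n, v <- adj u].

Definition offset (i : nat) : nat := \sum_(v < n | v < i) size (adj v).

Lemma mem_arcs uv : (uv \in arcs) = adjacent uv.1 uv.2.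
Proof.
case: uv => u v; apply/allpairsPdep/idP => /= [[u' [v' [_ + [-> ->]]]]|auv].
  by rewrite (perm_mem (adjP u')) mem_enum inE.
by exists u, v; split; rewrite ?(perm_mem (adjP u)) ?mem_enum ?inE.
Qed.

Lemma uniq_arcs : uniq arcs.
Proof.
apply: allpairs_uniq_dep => [|u _|]; first exact: enum_uniq.
  by rewrite (perm_uniq (adjP u)) enum_uniq.
by case=> u v [u' v'] _ _ /= [eu ev]; subst.
Qed.

Lemma count_arcs (P : pred ('I_n * 'I_n)) :
  count P arcs = #|[set uv | adjacent uv.1 uv.2 && P uv]|.
Proof.
rewrite -size_filter -(card_uniqP (filter_uniq P uniq_arcs)).
by apply: eq_card => uv; rewrite !inE mem_filter mem_arcs andbC.
Qed.

(** Reorienting an arc from its smaller to its larger end is injective on arcs of which at most one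
    direction satisfies [P]. *)
Lemma count_arcs_asym (P : pred ('I_n * 'I_n)) :
  (forall u v, adjacent u v -> P (u, v) -> ~~ P (v, u)) ->
  count P arcs <= num_edges I.
Proof.
move=> asymP; rewrite count_arcs.
pose g (uv : 'I_n * 'I_n) := if uv.1 < uv.2 then uv else (uv.2, uv.1).
rewrite -(@card_in_imset _ _ g); last first.
  move=> [u v] [u' v']; rewrite !inE /g /= => /andP[auv Puv] /andP[auv' Puv'].
  case: ltnP => _; case: ltnP => _ // [eu ev]; move: Puv Puv' auv auv'.
  - by rewrite eu ev => /asymP + Puv' auv _ => /(_ auv); rewrite Puv'.
  - by rewrite eu ev => /asymP + Puv' auv _ => /(_ auv); rewrite Puv'.
  - by rewrite eu ev.
apply: subset_leq_card; apply/subsetP => _ /imsetP[[u v] + ->].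
rewrite !inE /g /= => /andP[auv _]; case: (ltnP u v) => [lt_uv|] /=.
  by rewrite lt_uv auv.
rewrite leq_eqVlt adjacent_sym auv andbT => /orP[/eqP/val_inj vu|-> //].
by rewrite vu adjacent_irr in auv.
Qed.

Lemma size_arcs_leq : size arcs <= 2 * num_edges I.
Proof.
rewrite -(count_predC (fun uv : 'I_n * 'I_n => uv.1 < uv.2)) mul2n -addnn.
apply: leq_add; apply: count_arcs_asym => u v auv /=; first by lia.
rewrite -leqNgt leq_eqVlt negbK => /orP[/eqP/val_inj vu|//].
by rewrite vu adjacent_irr in auv.
Qed.

Lemma count_arcs_fst (A : {set 'I_n}) :
  count (fun uv => uv.1 \in A) arcs <= #|A| * max_degree I.
Proof.
rewrite count_arcs -sum1dep_card -sum_nat_const.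
rewrite (eq_bigl (fun uv => (uv.1 \in A) && adjacent uv.1 uv.2)); last first.
  by move=> uv; rewrite andbC.
rewrite -(pair_big_dep (fun u => u \in A) (fun u v : 'I_n => adjacent u v)
  (fun _ _ => 1)) /=.
apply: leq_sum => u _; rewrite sum1dep_card.
exact: (leq_bigmax (F := fun v : 'I_n => #|[set u | adjacent v u]|)).
Qed.

Lemma arcs_nil : n <= 1 -> arcs = [::].
Proof.
move=> n_le1; case: arcs mem_arcs => // uv s /(_ uv); rewrite mem_head.
rewrite (_ : uv.1 = uv.2) ?adjacent_irr //.
by apply: val_inj => /=; have := ltn_ord uv.1; have := ltn_ord uv.2; lia.
Qed.

Lemma adjacent_ex (u : 'I_n) : 1 < n -> exists v, adjacent u v.
Proof.
move=> n_gt1; have [w neq_wu] : exists w, w != u.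
  have [u0|u_gt0] := posnP u; first by exists (Ordinal n_gt1); rewrite -val_eqE /= u0.
  by exists (Ordinal (num_vertices_gt0 I)); rewrite -val_eqE /= eq_sym -lt0n.
case/connectP: (adjacent_conn u w) neq_wu => [[|v p] /=].
  by move=> _ ->; rewrite eqxx.
by case/andP=> auv _ _ _; exists v.
Qed.

(** By connectivity every vertex has a neighbour, hence is the first end of some arc. *)
Lemma leq_vertices_arcs : 1 < n -> n <= size arcs.
Proof.
move=> n_gt1; rewrite -(count_predT arcs) count_arcs.
rewrite -[leqLHS]card_ord -cardsT.
have -> : [set: 'I_n] = fst @: [set uv | adjacent uv.1 uv.2 && predT uv].
  apply/setP => u; rewrite inE; apply/esym/imsetP.
  have [v auv] := adjacent_ex u n_gt1.
  by exists (u, v); rewrite ?inE /= ?auv.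
exact: leq_imset_card.
Qed.

Lemma max_degree_gt0 : 1 < n -> 0 < max_degree I.
Proof.
move=> n_gt1; pose u := Ordinal (num_vertices_gt0 I).
apply: leq_trans (leq_bigmax (F := fun v : 'I_n => #|[set u | adjacent v u]|) u).
by have [v auv] := adjacent_ex u n_gt1; apply/card_gt0P; exists v; rewrite inE.
Qed.

Lemma num_edges_gt0 : 1 < n -> 0 < num_edges I.
Proof.
by move=> n_gt1; have := leq_vertices_arcs n_gt1; have := size_arcs_leq; lia.
Qed.

Let rows := [seq [seq (u, v) | v <- adj u] | u <- enum 'I_n].

Let size_rows : size rows = n.
Proof. by rewrite size_map size_enum_ord. Qed.

Let nth_rows (u : 'I_n) : nth [::] rows u = [seq (u, v) | v <- adj u].
Proof. by rewrite (nth_map u) ?size_enum_ord // nth_ord_enum. Qed.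

Let offsetE i : i <= n -> offset i = sumn (take i (shape rows)).
Proof.
move=> le_in; rewrite /offset.
pose F j := nth 0 (shape rows) j.
rewrite (eq_bigr (fun v : 'I_n => F v)) => [|v _]; last first.
  by rewrite /F (nth_map [::]) ?size_rows // nth_rows size_map.
rewrite -(big_ord_widen _ F le_in) sumnE (big_nth 0).
have -> : size (take i (shape rows)) = i by rewrite size_takel // size_map size_rows.
rewrite big_mkord.
by apply: eq_bigr => j _; rewrite nth_take.
Qed.

Lemma offset0 : offset 0 = 0.
Proof. by rewrite /offset big_pred0. Qed.

Lemma offsetS (u : 'I_n) : offset u.+1 = offset u + size (adj u).
Proof. exact: sum_ltS. Qed.

Lemma offset_le i j : i <= j -> offset i <= offset j.
Proof.
move=> le_ij; rewrite /offset [leqRHS]big_mkcond [leqLHS]big_mkcond.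
by apply: leq_sum => v _; case: ifP => // ltvi; rewrite (leq_trans ltvi).
Qed.

Lemma offset_size : offset n = size arcs.
Proof.
rewrite offsetE // size_flatten take_oversize // size_map.
by rewrite size_rows.
Qed.

Lemma offset_le_size i : offset i <= size arcs.
Proof.
rewrite -offset_size; case: (leqP i n) => [le_in|lt_ni]; first exact: offset_le.
rewrite /offset (eq_bigl (fun v : 'I_n => v < n)) // => v.
by rewrite ltn_ord (ltn_trans (ltn_ord v)).
Qed.

Lemma nth_arcs x0 (u : 'I_n) p :
  offset u <= p < offset u.+1 -> (nth x0 arcs p).1 = u.
Proof.
rewrite offsetS => /andP[le_p lt_p].
have pE : p = flatten_index (shape rows) u (p - offset u).
  by rewrite /flatten_index -offsetE ?(ltnW (ltn_ord u)) // subnKC.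
have lt_q : p - offset u < nth 0 (shape rows) u.
  rewrite (nth_map [::]) ?size_rows // nth_rows size_map; lia.
rewrite nth_flatten {1 2}pE flatten_indexKl // flatten_indexKr //.
rewrite nth_rows; set q := p - offset u.
have lt_q' : q < size (adj u) by rewrite /q; lia.
by rewrite (nth_map u).
Qed.

(** After a swap is undone, the scan resumes behind its position; this shows that the position lies
    in the row of the stored vertex. *)
Lemma offset_arc x0 p (u := (nth x0 arcs p).1) :
  p < size arcs -> offset u <= p < offset u.+1.
Proof.
move=> lt_p; have ex_i : exists i, p < offset i by exists n; rewrite offset_size.
case: (ex_minnP ex_i) => -[|i]; first by rewrite offset0.
move=> lt_pi min_i; have lt_in : i < n by apply: min_i; rewrite offset_size.
have le_p : offset i <= p.
  by rewrite leqNgt; apply/negP => /min_i; rewrite ltnn.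
by rewrite /u (@nth_arcs x0 (Ordinal lt_in)) /= le_p.
Qed.

End Arcs.

Section Encoding.

Variable I : instance.
Local Notation n := (num_vertices I).
Variable adj : 'I_n -> seq 'I_n.
Local Notation inp := (encode adj).

Let nthS (x : nat) s i : nth 0 (x :: s) i.+1 = nth 0 s i. Proof. by []. Qed.

Lemma size_encode : size inp = 2 * n + 2 + size (arcs adj).
Proof.
rewrite /encode -cat1s !size_cat (size_map _ (enum _)) (size_map _ (iota _ _)).
rewrite (size_map _ (flatten _)) size_enum_ord size_iota [size [:: _]]/=.
have -> : size (flatten [seq adj v | v <- enum 'I_n]) = size (arcs adj).
  rewrite !size_flatten /shape -!map_comp; congr sumn; apply: eq_map => u /=.
  by rewrite size_map.
lia.
Qed.

Lemma nth_encode_token (v : 'I_n) : nth 0 inp (1 + v) = initial I v.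
Proof.
rewrite /encode add1n nthS nth_cat size_map size_enum_ord ltn_ord.
by rewrite (nth_map v) ?size_enum_ord // nth_ord_enum.
Qed.

Lemma nth_encode_offset i : i <= n -> nth 0 inp (n + 1 + i) = offset adj i.
Proof.
move=> le_in; rewrite /encode addn1 addSn nthS nth_cat size_map size_enum_ord.
rewrite ltnNge leq_addr [~~ true]/= addKn nth_cat size_map size_iota ltnS le_in.
by rewrite (nth_map 0) ?size_iota // nth_iota.
Qed.

Lemma nth_encode_arc x0 p : p < size (arcs adj) ->
  nth 0 inp (2 * n + 2 + p) = (nth x0 (arcs adj) p).2.
Proof.
move=> lt_p; have -> : 2 * n + 2 + p = (n + (n.+1 + p)).+1 by lia.
rewrite /encode nthS nth_cat size_map size_enum_ord.
rewrite ltnNge leq_addr [~~ true]/= addKn nth_cat size_map size_iota.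
rewrite ltnNge leq_addr [~~ true]/= addKn.
have -> : flatten [seq adj v | v <- enum 'I_n] = [seq uv.2 | uv <- arcs adj].
  rewrite map_allpairs; congr flatten; apply: eq_map => u.
  by rewrite map_id.
by rewrite -map_comp (nth_map x0).
Qed.

End Encoding.

Notation "$ x" := (Reg x) (at level 1, format "$ x").
Notation "# i" := (Lit i) (at level 1, format "# i").
Notation "a [+] b" := (Op Plus a b) (at level 50, left associativity).
Notation "a [-] b" := (Op Minus a b) (at level 50, left associativity).
Notation "a [*] b" := (Op Times a b) (at level 40, left associativity).
Notation "a [=] b" := (Op IsEq a b) (at level 70).
Notation "a [<] b" := (Op IsLt a b) (at level 70).
Notation "x ::= e" := (Assign x e) (at level 75).
Notation "P ;; Q" := (Seq P Q) (at level 80, right associativity).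

(** * Depth-first search *)

Module Dfs.

(* rB is the first cell of the stack, rD the number of swaps allowed, rJ the
   number of swaps made, rU and rP a vertex and a position in the concatenated
   adjacency lists, where the search for the next swap goes on; rF is reset when
   a solution is found. The mode rS is 0 on entering a node, 1 when looking for
   the next swap there and 2 when leaving it. *)
Notation rN := 0.
Notation rB := 1.
Notation rD := 2.
Notation rJ := 3.
Notation rU := 4.
Notation rP := 5.
Notation rS := 6.
Notation rF := 7.
Notation rV := 8.
Notation rM := 9.
Notation rI := 10.
Notation rX := 11.
Notation rY := 12.

Section Programs.

(* lookup puts the token of vertex rX in rY, and apply updates the representation
   of the configuration after the swap of rU and rV. *)
Variables lookup apply : cmd.

Definition count_misplaced : cmd :=
  rM ::= #0;; rI ::= #0;;
  While ($rI [<] $rN) (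
    rX ::= $rI;; lookup;;
    If ($rY [=] $rI) Skip (rM ::= $rM [+] #1);;
    rI ::= $rI [+] #1).

Definition enter : cmd :=
  count_misplaced;;
  If ($rJ [=] $rD)
    (If $rM (rS ::= #2) (rF ::= #0))
    (If (($rD [-] $rJ) [+] ($rD [-] $rJ) [<] $rM)
      (rS ::= #2)
      (rU ::= #0;; rP ::= #0;; rS ::= #1)).

Definition push : cmd :=
  Store ($rB [+] $rJ [+] $rJ) $rU;;
  Store ($rB [+] $rJ [+] $rJ [+] #1) $rP;;
  apply;;
  rJ ::= $rJ [+] #1;; rS ::= #0.

(** A row whose vertex holds its own token is skipped in one step. The scan thus pays for n rows and
    for the arcs out of misplaced vertices only, which the degree bound requires. The sum of the two
    comparisons that guards [push] acts as a disjunction. *)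
Definition advance : cmd :=
  If ($rU [<] $rN)
    (If ($rP [<] Input ($rN [+] $rU [+] #2))
      (rX ::= $rU;; lookup;;
       If ($rY [=] $rU)
         (rP ::= Input ($rN [+] $rU [+] #2);; rU ::= $rU [+] #1)
         (rV ::= Input ($rN [+] $rN [+] #2 [+] $rP);; rX ::= $rV;; lookup;;
          If (($rY [=] $rV) [+] ($rU [<] $rV)) push (rP ::= $rP [+] #1)))
      (rU ::= $rU [+] #1))
    (rS ::= #2).

Definition backtrack : cmd :=
  If ($rJ [=] #0)
    (rD ::= $rD [+] #1;; rS ::= #0)
    (rJ ::= $rJ [-] #1;;
     rU ::= Work ($rB [+] $rJ [+] $rJ);;
     rP ::= Work ($rB [+] $rJ [+] $rJ [+] #1);;
     rV ::= Input ($rN [+] $rN [+] #2 [+] $rP);;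
     apply;;
     rP ::= $rP [+] #1;; rS ::= #1).

Definition body : cmd :=
  If ($rS [=] #0) enter (If ($rS [=] #1) advance backtrack).

Definition emit_stack : cmd :=
  rI ::= #0;;
  While ($rI [<] $rD) (
    Emit (Work ($rB [+] $rI [+] $rI));;
    Emit (Input ($rN [+] $rN [+] #2 [+] Work ($rB [+] $rI [+] $rI [+] #1)));;
    rI ::= $rI [+] #1).

(** With k = 0 there may be too few cells for the token array of [dense_init], so this test reads
    the input only and writes no work cell. *)
Definition check_initial : cmd :=
  rN ::= Input #0;; rI ::= #0;; rM ::= #0;;
  While ($rI [<] $rN) (
    If (Input (#1 [+] $rI) [=] $rI) Skip (rM ::= #1);;
    rI ::= $rI [+] #1).

(* init sets rB and builds the representation of the initial configuration. *)
Definition prog (init : cmd) : cmd :=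
  check_initial;;
  If $rM
    (init;; rD ::= #1;; rJ ::= #0;; rS ::= #0;; rF ::= #1;;
     While $rF body;; emit_stack)
    Skip.

End Programs.

Section CheckInitial.

Variable I : instance.
Local Notation n := (num_vertices I).
Variable adj : 'I_n -> seq 'I_n.
Local Notation inp := (encode adj).
Variables (W space : nat).
Hypothesis leW : size inp + space < W.

Lemma check_initialP st :
  wp W space inp check_initial st (fun t st' => [/\ t <= 22 * n + 20,
    regs st' rN = n, regs st' rM = (initial I != 1%g) :> nat,
    work st' = work st & output st' = output st]).
Proof.
have szE := size_encode adj; have n_gt0 := num_vertices_gt0 I.
apply: wp_seq; apply: wp_assign; wsimp; do 2![split; first lia].
do 2![apply: wp_seq; apply: wp_assign; wsimp; split; first lia].
pose J i st' := [/\ i <= n, regs st' rN = n, regs st' rI = i,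
  regs st' rM = ~~ [forall v : 'I_n, (v < i) ==> (initial I v == v)] :> nat &
  work st' = work st /\ output st' = output st].
apply: (@wp_for _ _ _ J n 16).
- move=> i st1 [le_in rNE rIE rME [wkE outE]] lt_in.
  wsimp; rewrite rIE rNE lt_in; split; first by split; lia.
  pose u := Ordinal lt_in.
  have tokE : nth 0 inp (1 + i) = initial I u by rewrite -(nth_encode_token adj).
  have allE : [forall v : 'I_n, (v < i.+1) ==> (initial I v == v)] =
      [forall v : 'I_n, (v < i) ==> (initial I v == v)] && (initial I u == u).
    apply/forallP/andP => [all_i|[/forallP all_i init_u] v].
      split; last by have := all_i u; rewrite /= ltnSn.
      by apply/forallP => v; apply/implyP => lt_v; have := all_i v; rewrite ltnS ltnW.
    rewrite ltnS leq_eqVlt; apply/implyP => /orP[/eqP vu|lt_v].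
      by have -> : v = u by exact: val_inj.
    by have := all_i v; rewrite lt_v.
  have iuE : (initial I u == u) = (initial I u == i :> nat) by [].
  apply: wp_seq; apply: wp_if; wsimp; rewrite rIE tokE.
  do 3![split; first lia]; split; first by case: (_ == _); lia.
  apply: bool_cases => init_u.
    apply: wp_skip; apply: wp_assign; wsimp; rewrite rIE; do 3![split; first lia].
    by split; wsimp => //; rewrite ?addn1 // allE iuE init_u andbT.
  apply: wp_assign; wsimp; split; first lia.
  apply: wp_assign; wsimp; rewrite rIE; do 3![split; first lia].
  by split; wsimp => //; rewrite ?addn1 // allE iuE (negPf init_u) andbF.
- by move=> st1 [_ rNE rIE _ _]; wsimp; rewrite rIE rNE ltnn; split=> //; lia.
- split=> //; wsimp.
  by have -> : [forall v : 'I_n, (v < 0) ==> (initial I v == v)] by apply/forallP.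
- move=> t st1 le_t [_ rNE _ rME [wkE outE]]; split=> //.
    by move: le_t; wsimp; lia.
  rewrite rME; congr (nat_of_bool (~~ _)).
  apply/forallP/eqP => [all_v|-> v]; last by rewrite perm1 eqxx implybT.
  apply/permP => v; rewrite perm1; apply/eqP.
  by have := all_v v; rewrite ltn_ord.
Qed.

Lemma prog_identityP lookup apply init : initial I = 1%g ->
  wp W space inp (prog lookup apply init) start (fun t st' =>
    t <= 22 * n + 30 /\
    exists2 s : seq ('I_n * 'I_n), output st' = encode_swaps s & optimal s).
Proof.
move=> init1; apply: wp_seq; apply: (wp_mono (check_initialP start)).
move=> t st [le_t _ rME _ outE]; apply: wp_if; wsimp; rewrite rME init1 eqxx.
split=> // _; apply: wp_skip; split; first lia.
exists [::] => //; split; last by [].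
by rewrite solvesE /sorts /= init1 eqxx.
Qed.

End CheckInitial.

(** * Correctness of the depth-first search for any representation of configurations *)

Section Correctness.

Variable I : instance.
Local Notation n := (num_vertices I).
Variable adj : 'I_n -> seq 'I_n.
Hypothesis adjP : adjacency_lists adj.
Local Notation inp := (encode adj).
Local Notation arcs := (arcs adj).
Local Notation config := {perm 'I_n}.

Variables (W space base k : nat).
Hypothesis leW : size inp + space < W.
Hypothesis le_space : base + 2 * k <= space.

Let v0 : 'I_n := Ordinal (num_vertices_gt0 I).

Definition arc p := nth (v0, v0) arcs p.
Definition moves (ps : seq nat) := [seq arc p | p <- ps].
Definition conf_of ps : config := play (initial I) (moves ps).

(* The stack holds positions in arcs, together with the first ends of the arcs,
   which cannot be recovered quickly from the positions. *)
Definition stack_at (ps : seq nat) (wk : nat -> nat) : Prop :=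
  forall i, i < size ps -> nth 0 ps i < size arcs /\
    wk (base + i + i) = (arc (nth 0 ps i)).1 /\
    wk (base + i + i + 1) = nth 0 ps i.

Variables (lookup apply : cmd) (tau : nat) (conf_at : config -> (nat -> nat) -> Prop).

Local Notation wp := (wp W space inp).

(** Registers below 12 belong to the search; [lookup] answers in [rY], which is register 12, and
    later ones are scratch. The representation lives in the cells below [base] and the stack in
    those from [base] on. *)
Hypothesis lookupP : forall ps st (x : 'I_n), size ps <= k ->
  regs st rN = n -> regs st rB = base -> regs st rJ = size ps ->
  regs st rX = x -> stack_at ps (work st) -> conf_at (conf_of ps) (work st) ->
  wp lookup st (fun t st' => [/\ t <= tau,
    forall r, r < 12 -> regs st' r = regs st r, regs st' rY = conf_of ps x,
    work st' = work st & output st' = output st]).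

Hypothesis applyP : forall c st (u v : 'I_n), regs st rU = u -> regs st rV = v ->
  conf_at c (work st) ->
  wp apply st (fun t st' => [/\ t <= tau,
    forall r, r < 12 -> regs st' r = regs st r,
    forall a, base <= a -> work st' a = work st a,
    conf_at (swap c (u, v)) (work st') & output st' = output st]).

Hypothesis conf_at_base : forall c wk wk',
  (forall a, a < base -> wk' a = wk a) -> conf_at c wk -> conf_at c wk'.

Definition invariant f d ps st : Prop :=
  [/\ [/\ regs st rN = n, regs st rB = base, regs st rD = d,
        regs st rJ = size ps & regs st rF = f],
      stack_at ps (work st), conf_at (conf_of ps) (work st) &
      output st = [::]].

Lemma size_inpE : size inp = 2 * n + 2 + size arcs.
Proof. exact: size_encode. Qed.

Lemma ltn_bW (b : bool) : b < W.
Proof. by have := size_inpE; case: b; lia. Qed.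

Lemma ltn_bbW (b b' : bool) : b + b' < W.
Proof. by have := size_inpE; case: b; case: b'; lia. Qed.

Lemma count_misplacedP ps st :
  regs st rN = n -> regs st rB = base -> regs st rJ = size ps -> size ps <= k ->
  stack_at ps (work st) -> conf_at (conf_of ps) (work st) ->
  wp (count_misplaced lookup) st (fun t st' => [/\ t <= n * (tau + 25) + 10,
    forall r, r < 9 -> regs st' r = regs st r,
    regs st' rM = #|misplaced (conf_of ps)|,
    work st' = work st & output st' = output st]).
Proof.
move=> rNE rBE rJE le_k stk cnf; have szE := size_inpE.
set c := conf_of ps.
do 2![apply: wp_seq; apply: wp_assign; wsimp; split; first lia].
pose J i st' := [/\ i <= n, forall r, r < 9 -> regs st' r = regs st r,
  regs st' rI = i,
    regs st' rM <= i /\ regs st' rM = \sum_(v < n | v < i) (c v != v)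
  & work st' = work st /\ output st' = output st].
apply: (@wp_for _ _ _ J n (tau + 20)).
- move=> i st1 [le_in fr rIE [leM rME] [wkE outE]] lt_in; wsimp.
  rewrite rIE fr // rNE; split; first by split; lia.
  apply: wp_seq; apply: wp_assign; wsimp; rewrite rIE; apply: wp_seq.
  pose u := Ordinal lt_in.
  apply: wp_mono (lookupP (ps := ps) (x := u) _ _ _ _ _ _ _) _; wsimp;
    rewrite ?fr ?wkE //.
  move=> t st2 [le_t fr2 rYE wk2 out2]; apply: wp_seq; apply: wp_if; wsimp.
  have rI2 : regs st2 rI = i by rewrite fr2.
  have rM2 : regs st2 rM = regs st1 rM by rewrite fr2.
  rewrite rYE rI2; split; first exact: ltn_bW.
  have -> : (conf_of ps u == i :> nat) = (c u == u) by [].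
  have sumE : \sum_(v < n | v < i.+1) (c v != v) =
      \sum_(v < n | v < i) (c v != v) + (c u != u) := sum_ltS _ u.
  have frS r : r < 9 -> regs st2 r = regs st r.
    by move=> lt_r; rewrite fr2 ?setr_lt ?fr // (leq_trans lt_r).
  apply: bool_cases => cu.
    apply: wp_skip; apply: wp_assign; wsimp; rewrite rI2.
    do 3![split; first lia]; split=> //.
    - by move=> r lt_r; rewrite /= setr_lt ?frS // (leq_trans lt_r).
    - by wsimp; rewrite addn1.
    - by wsimp; rewrite rM2 sumE cu addn0; split=> //; apply: leqW.
    - by wsimp; rewrite wk2 out2.
  apply: wp_assign; wsimp; rewrite rM2; do 2![split; first lia].
  apply: wp_assign; wsimp; rewrite rI2.
  do 3![split; first lia]; split=> //.
  - by move=> r lt_r; rewrite /= !setr_lt ?frS // (leq_trans lt_r).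
  - by wsimp; rewrite addn1.
  - by wsimp; rewrite sumE cu addn1 -rME addn1.
  - by wsimp; rewrite wk2 out2.
- move=> st1 [_ fr rIE _ _]; wsimp; rewrite rIE fr // rNE ltnn; split=> //; lia.
- split=> //; last by wsimp; rewrite big_pred0.
  by move=> r lt_r; rewrite /= !setr_lt // (leq_trans lt_r).
move=> t st1 le_t [_ fr rIE [_ rME] [wkE outE]]; split=> //.
  by move: le_t; wsimp; lia.
rewrite rME -sum1_card [RHS]big_mkcond /=.
by rewrite big_mkcond; apply: eq_bigr => v _; rewrite ltn_ord inE; case: eqP.
Qed.

Definition at_node mode d ps st : Prop := invariant 1 d ps st /\ regs st rS = mode.

Definition at_arc d ps u p st : Prop :=
  [/\ at_node 1 d ps st, regs st rU = u, regs st rP = p, u <= n &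
    offset adj u <= p <= offset adj u.+1].

(** [A] bounds one step of [advance] or [backtrack], and n times [A] a call of [enter]. It contains
    3 * [tau] because [advance] makes at most two lookups and one application. [K] adds the loop
    test and the dispatch on the mode. *)
Variables A K : nat.
Hypothesis AE : A = 3 * tau + 150.
Hypothesis KE : K = A + 20.

Lemma invariantW f d ps st f' d' st' : invariant f d ps st ->
  regs st' rN = regs st rN -> regs st' rB = regs st rB ->
  regs st' rJ = regs st rJ -> regs st' rD = d' -> regs st' rF = f' ->
  work st' = work st -> output st' = output st -> invariant f' d' ps st'.
Proof.
case=> -[rNE rBE rDE rJE rFE] stk cnf outE eN eB eJ eD eF eW eO.
by rewrite /invariant eN eB eJ eD eF eW eO; split.
Qed.

Lemma enterP d ps st : at_node 0 d ps st -> size ps <= d -> d <= k ->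
  wp (enter lookup) st (fun t st' => t <= n * A /\
    if size ps == d then
      if misplaced (conf_of ps) == set0 then invariant 0 d ps st'
      else at_node 2 d ps st'
    else if 2 * (d - size ps) < #|misplaced (conf_of ps)| then at_node 2 d ps st'
    else at_arc d ps 0 0 st').
Proof.
case=> [[[rNE rBE rDE rJE rFE] stk cnf outE] rSE] le_d le_k.
have szE := size_inpE; have n_gt0 := num_vertices_gt0 I.
set M := #|misplaced (conf_of ps)|.
have leM : M <= n by rewrite -[leqRHS]card_ord max_card.
apply: wp_seq; apply: (wp_mono (count_misplacedP rNE rBE rJE _ stk cnf)); first lia.
move=> t st1 [le_t fr rME wkE outE1].
have le_tn : n * (tau + 25) + 10 + 100 <= n * A by rewrite AE; nia.
have inv1 : invariant 1 d ps st1.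
  by apply: (invariantW (st := st) (f := 1) (d := d)) => //; rewrite ?fr.
apply: wp_if; wsimp; rewrite !fr // rJE rDE; split; first exact: ltn_bW.
apply: bool_cases => [szd|szd].
  rewrite szd; apply: wp_if; wsimp; rewrite rME -/M; split=> [M_gt0|M0].
    apply: wp_assign; wsimp; do 2![split; first lia].
    by rewrite -cards_eq0 -/M gtn_eqF.
  apply: wp_assign; wsimp; do 2![split; first lia].
  rewrite -cards_eq0 -/M M0 eqxx.
  by apply: invariantW inv1 _ _ _ _ _ _ _ => //; wsimp; rewrite fr.
have [rJ1 rD1] : regs st1 rJ = size ps /\ regs st1 rD = d by rewrite !fr.
apply: wp_if; wsimp; rewrite rJ1 rD1 rME -/M.
do 3![split; first lia]; split; first exact: ltn_bW.
rewrite (negPf szd) mul2n -addnn.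
apply: bool_cases => [lt2|ge2].
  by rewrite lt2; apply: wp_assign; wsimp; do 2![split; first lia].
rewrite (negPf ge2); apply: wp_seq; apply: wp_assign; wsimp; split; first lia.
apply: wp_seq; apply: wp_assign; wsimp; split; first lia.
apply: wp_assign; wsimp; do 2![split; first lia]; split=> //.
by rewrite offset0.
Qed.

Lemma arc_lt p : p < size arcs -> adjacent (arc p).1 (arc p).2.
Proof. by move=> lt_p; have := mem_arcs adjP (arc p); rewrite mem_nth. Qed.

Lemma pushP d ps p st : at_node 1 d ps st -> size ps < d -> d <= k ->
  p < size arcs -> regs st rU = (arc p).1 -> regs st rV = (arc p).2 ->
  regs st rP = p ->
  wp (push apply) st (fun t st' => t <= tau + 40 /\ at_node 0 d (rcons ps p) st').
Proof.
case=> [[[rNE rBE rDE rJE rFE] stk cnf outE] rSE] lt_d le_d lt_p rUE rVE rPE.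
have szE := size_inpE.
apply: wp_seq; apply: wp_store; wsimp; rewrite rBE rJE; do 3![split; first lia].
apply: wp_seq; apply: wp_store; wsimp; rewrite rBE rJE; do 5![split; first lia].
apply: wp_seq; rewrite rUE rPE.
have stk2 : conf_at (conf_of ps)
    (update (update (work st) (base + size ps + size ps) (arc p).1)
      (base + size ps + size ps + 1) p).
  by apply: conf_at_base cnf => a lt_a; rewrite /update !ltn_eqF //; lia.
apply: wp_mono (applyP (u := (arc p).1) (v := (arc p).2) _ _ _) _;
  [by []|by []|exact: stk2|].
move=> t st1 [le_t fr wkE cnf1 outE1]; wsimp.
apply: wp_seq; apply: wp_assign; wsimp; rewrite !fr //=.
do 2![split; first lia]; apply: wp_assign; wsimp; do 2![split; first lia].
split=> //; split=> //=.
- by wsimp; rewrite !fr //; split=> //; rewrite rJE size_rcons addn1.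
- move=> i; rewrite size_rcons ltnS leq_eqVlt nth_rcons => /orP[/eqP->|lt_i].
    rewrite ltnn eqxx; split=> //; split; rewrite wkE /update /= ?eqxx //; try lia.
    by rewrite ltn_eqF //; lia.
  rewrite lt_i; have [lt_i' [e1 e2]] := stk i lt_i; split=> //.
  by split; rewrite wkE /update /=; try lia; do 2![rewrite ltn_eqF; try lia].
- move: cnf1; rewrite -surjective_pairing /conf_of /moves map_rcons play_rcons.
  by [].
- by rewrite outE1.
Qed.

(* A swap of two misplaced vertices is tried from the smaller one only, so that an
   edge is tried at most once. *)
Definition candidate (c : config) (uv : 'I_n * 'I_n) : bool :=
  (uv.1 \in misplaced c) && ((uv.2 \notin misplaced c) || (uv.1 < uv.2)).

Lemma advanceP d ps u p st : at_arc d ps u p st -> size ps < d -> d <= k ->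
  wp (advance lookup apply) st (fun t st' => t <= A /\
    if u < n then
      if p < offset adj u.+1 then
        if (arc p).1 \notin misplaced (conf_of ps) then
          at_arc d ps u.+1 (offset adj u.+1) st'
        else if candidate (conf_of ps) (arc p) then at_node 0 d (rcons ps p) st'
        else at_arc d ps u p.+1 st'
      else at_arc d ps u.+1 p st'
    else at_node 2 d ps st').
Proof.
case=> [[[[rNE rBE rDE rJE rFE] stk cnf outE] rSE] rUE rPE le_u p_bnd] lt_d le_d.
have szE := size_inpE; set c := conf_of ps.
apply: wp_if; wsimp; rewrite rUE rNE; split; first exact: ltn_bW.
apply: bool_cases => [lt_un|ge_un]; last first.
  by rewrite (negPf ge_un); apply: wp_assign; wsimp; do 2![split; first lia].
rewrite lt_un; have offE := nth_encode_offset adj lt_un.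
have off_size := offset_le_size adj u.+1.
have addrE : n + u + 2 = n + 1 + u.+1 by lia.
apply: wp_if; wsimp; rewrite rUE rNE rPE addrE offE.
do 4![split; first lia]; split; first exact: ltn_bW.
apply: bool_cases => [lt_p|ge_p]; last first.
  rewrite (negPf ge_p); apply: wp_assign; wsimp; rewrite rUE.
  do 3![split; first lia]; split; wsimp => //; first exact: addn1.
  have -> : p = offset adj u.+1 by lia.
  by rewrite leqnn offset_le.
rewrite lt_p; pose u' := Ordinal lt_un.
have lt_pa : p < size arcs by exact: leq_trans lt_p _.
have arc1 : (arc p).1 = u'.
  by rewrite /arc (@nth_arcs _ adj _ u') //; case/andP: p_bnd => -> _.
set v := (arc p).2.
apply: wp_seq; apply: wp_assign; wsimp; apply: wp_seq.
apply: (wp_mono (lookupP (ps := ps) (x := u') _ _ _ _ _ _ _)) => //; first lia.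
move=> t st1 [le_t fr rYE wkE outE1].
have frN : regs st1 rN = n by rewrite fr.
have frU : regs st1 rU = u by rewrite fr.
have frP : regs st1 rP = p by rewrite fr.
have inv1 : at_node 1 d ps st1.
  split; last by rewrite fr.
  by rewrite /invariant !fr // wkE outE1; split.
apply: wp_if; wsimp; rewrite rYE frU; split; first exact: ltn_bW.
have -> : (conf_of ps u' == u :> nat) = ((arc p).1 \notin misplaced c).
  by rewrite inE negbK arc1.
apply: bool_cases => [mis_u|].
  rewrite mis_u; apply: wp_seq; apply: wp_assign; wsimp.
  rewrite frN frU addrE offE; do 4![split; first lia].
  apply: wp_assign; wsimp; rewrite frU; do 3![split; first lia].
  by split; wsimp => //; [exact: addn1 | rewrite leqnn offset_le].
rewrite negbK => mis_u; rewrite mis_u /=.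
have vE : nth 0 inp (n + n + 2 + p) = v.
  by rewrite (_ : n + n = 2 * n) ?(nth_encode_arc (v0, v0)) //; lia.
apply: wp_seq; apply: wp_assign; wsimp; rewrite frN frP vE.
do 5![split; first lia]; apply: wp_seq; apply: wp_assign; wsimp.
apply: wp_seq.
apply: (wp_mono (lookupP (ps := ps) (x := v) _ _ _ _ _ _ _)) => //;
  wsimp; rewrite ?fr ?wkE //; first lia.
move=> t2 st2 [le_t2 fr2 rYE2 wkE2 outE2].
apply: wp_if; wsimp; rewrite rYE2 !fr2 //; wsimp; rewrite frU.
do 2![split; first exact: ltn_bW].
have eN : (conf_of ps v == v :> nat) = (v \notin misplaced c) by rewrite inE negbK.
rewrite eN; split; first exact: ltn_bbW.
have candE : candidate c (arc p) = (v \notin misplaced c) || (u < v).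
  by rewrite /candidate mis_u arc1.
have inv2 : at_node 1 d ps st2.
  split; last by rewrite fr2 //; wsimp; rewrite fr.
  rewrite /invariant !fr2 // wkE2 outE2; wsimp; rewrite !fr // ?wkE ?outE1.
  by split.
split=> [cand|Ncand].
  have -> : candidate c (arc p).
    by rewrite candE; move: cand; case: (v \notin _); case: (u < v).
  apply: (wp_mono (pushP (p := p) inv2 lt_d le_d lt_pa _ _ _)).
  - by rewrite fr2 // arc1.
  - by rewrite fr2.
  - by rewrite fr2.
  - by move=> t3 st3 [le_t3 inv3]; split=> //; lia.
have -> : candidate c (arc p) = false.
  by rewrite candE; move: Ncand; case: (v \notin _); case: (u < v).
apply: wp_assign; wsimp; rewrite fr2 //; wsimp; rewrite frP.
do 3![split; first lia]; split; wsimp => //.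
- by rewrite fr2.
- exact: addn1.
- by case/andP: p_bnd => le_p _; rewrite leqW.
Qed.

Lemma backtrackP d ps p st : at_node 2 d (rcons ps p) st -> size ps < d -> d <= k ->
  wp (backtrack apply) st (fun t st' => t <= A /\
    at_arc d ps (arc p).1 p.+1 st').
Proof.
case=> [[[rNE rBE rDE rJE rFE] stk cnf outE] rSE] lt_d le_d.
have szE := size_inpE; set j := size ps; rewrite size_rcons -/j in rJE.
have [|lt_p [wkU wkP]] := stk j; first by rewrite size_rcons.
rewrite nth_rcons ltnn eqxx in lt_p wkU wkP.
have lt_u := ltn_ord (arc p).1; have lt_v := ltn_ord (arc p).2.
apply: wp_if; wsimp; rewrite rJE; split; first lia; split; first exact: ltn_bW.
apply: bool_cases => // _.
apply: wp_seq; apply: wp_assign; wsimp; rewrite rJE subn1 /=.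
do 2![split; first lia].
apply: wp_seq; apply: wp_assign; wsimp; rewrite rBE wkU; do 3![split; first lia].
apply: wp_seq; apply: wp_assign; wsimp; rewrite rBE wkP; do 5![split; first lia].
have vE : nth 0 inp (n + n + 2 + p) = (arc p).2.
  by rewrite (_ : n + n = 2 * n) ?(nth_encode_arc (v0, v0)) //; lia.
apply: wp_seq; apply: wp_assign; wsimp; rewrite rNE vE; do 5![split; first lia].
apply: wp_seq.
apply: (wp_mono (applyP (u := (arc p).1) (v := (arc p).2) _ _ _));
  [by []|by []|exact: cnf|].
move=> t st1 [le_t fr wkE cnf1 outE1]; wsimp.
apply: wp_seq; apply: wp_assign; wsimp; rewrite !fr //; wsimp.
do 2![split; first lia]; apply: wp_assign; wsimp.
do 2![split; first lia].
split; wsimp; rewrite ?fr //; wsimp => //.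
- split=> //; split; wsimp; rewrite ?fr //; wsimp => //.
  + move=> i lt_i; have [|lt_i' [e1 e2]] := stk i.
      by rewrite size_rcons ltnS ltnW.
    rewrite nth_rcons lt_i in e1 e2 lt_i' *.
    by split=> //; split; rewrite wkE //=; lia.
  + move: cnf1; rewrite -surjective_pairing /conf_of /moves map_rcons play_rcons.
    by rewrite swapK.
  + by rewrite outE1.
- exact: addn1.
- exact: ltnW.
- by have /andP[le_p lt_p'] := offset_arc (v0, v0) lt_p; rewrite leqW.
Qed.

Lemma backtrack0P d st : at_node 2 d [::] st -> d <= k ->
  wp (backtrack apply) st (fun t st' => t <= A /\ at_node 0 d.+1 [::] st').
Proof.
case=> [[[rNE rBE rDE rJE rFE] stk cnf outE] rSE] le_d.
have szE := size_inpE.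
apply: wp_if; wsimp; rewrite rJE; split; first lia; split; first exact: ltn_bW.
apply: bool_cases => // _; apply: wp_seq; apply: wp_assign; wsimp; rewrite rDE.
do 2![split; first lia]; apply: wp_assign; wsimp; do 2![split; first lia].
by split=> //; rewrite /invariant /=; wsimp; rewrite addn1.
Qed.

Local Notation reaches := (reaches W space inp $rF (body lookup apply)).

Definition distance_is (c : config) r : Prop := exists w,
  [/\ size w = r, sorts c w & forall w', sorts c w' -> r <= size w'].

Definition found d st : Prop := exists ps,
  [/\ invariant 0 d ps st, size ps = d & conf_of ps = 1%g].

Lemma distance0 c : distance_is c 0 -> c = 1%g.
Proof. by case=> w [/size0nil-> /andP[_ /eqP]]. Qed.

Lemma distanceS c r : distance_is c r.+1 -> exists2 p,
  p < size arcs & candidate c (arc p) /\ distance_is (swap c (arc p)) r.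
Proof.
case=> w [szw c_w min_w].
have c_neq1 : c != 1%g.
  by apply/eqP => c1; have := min_w [::]; rewrite /sorts /= c1 eqxx => /(_ isT).
have [t [w' [t_mis t_le adj_t szw' t_w']]] := sorts_misplaced_head c_neq1 c_w.
have t_arc : t \in arcs by rewrite (mem_arcs adjP).
exists (index t arcs); first by rewrite index_mem.
have -> : arc (index t arcs) = t by exact: nth_index.
split.
  rewrite /candidate t_mis; case: (_ \in _) t_le => //=.
  rewrite leq_eqVlt => /orP[/eqP/val_inj t12|//].
  by rewrite t12 adjacent_irr in adj_t.
exists w'; split=> //; first by rewrite szw in szw'; case: szw'.
move=> w2 /andP[adj2 w2P]; have := min_w (t :: w2).
by rewrite /sorts /= adj_t adj2 w2P => /(_ isT).
Qed.

Lemma distance_misplaced c r : distance_is c r -> #|misplaced c| <= 2 * r.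
Proof. by case=> w [<- /card_misplaced_sorts]. Qed.

Lemma step_enter d ps st T Q : at_node 0 d ps st -> size ps <= d -> d <= k ->
  (forall st', 
    (if size ps == d then
      if misplaced (conf_of ps) == set0 then invariant 0 d ps st'
      else at_node 2 d ps st'
    else if 2 * (d - size ps) < #|misplaced (conf_of ps)| then at_node 2 d ps st'
    else at_arc d ps 0 0 st') -> reaches st' T Q) ->
  reaches st (n * K + T) Q.
Proof.
move=> node le_d le_k next; have n_gt0 := num_vertices_gt0 I.
apply: (@reaches_le _ _ _ _ _ _ ((cost $rF + (4 + n * A)).+1 + T)); last first.
  apply: reaches_step; first by case: node => [[[_ _ _ _ rFE] _ _ _] _]; rewrite /= rFE.
  have szE := size_inpE.
  apply: wp_if; wsimp; case: (node) => _ ->; split; first lia.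
  split; first exact: ltn_bW.
  apply: bool_cases => // _; apply: (wp_mono (enterP node le_d le_k)).
  by move=> t st' [le_t post]; split; [lia|apply: next].
by rewrite KE mulnDr /=; lia.
Qed.

Lemma step_advance d ps u p st T Q : at_arc d ps u p st -> size ps < d -> d <= k ->
  (forall st', 
    (if u < n then
      if p < offset adj u.+1 then
        if (arc p).1 \notin misplaced (conf_of ps) then
          at_arc d ps u.+1 (offset adj u.+1) st'
        else if candidate (conf_of ps) (arc p) then at_node 0 d (rcons ps p) st'
        else at_arc d ps u p.+1 st'
      else at_arc d ps u.+1 p st'
    else at_node 2 d ps st') -> reaches st' T Q) ->
  reaches st (K + T) Q.
Proof.
move=> at_a le_d le_k next; have node : at_node 1 d ps st by case: at_a.
apply: (@reaches_le _ _ _ _ _ _ ((cost $rF + (8 + A)).+1 + T)); last first.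
  apply: reaches_step; first by case: node => [[[_ _ _ _ rFE] _ _ _] _]; rewrite /= rFE.
  have szE := size_inpE.
  apply: wp_if; wsimp; case: (node) => _ ->; split; first lia.
  split; first exact: ltn_bW.
  apply: bool_cases => // _; apply: wp_if; wsimp; case: (node) => _ ->.
  split; first lia; split; first exact: ltn_bW.
  apply: bool_cases => // _; apply: (wp_mono (advanceP at_a le_d le_k)).
  by move=> t st' [le_t post]; split; [lia|apply: next].
by rewrite KE /=; lia.
Qed.

Lemma step_backtrack d ps p st T Q : at_node 2 d (rcons ps p) st ->
  size ps < d -> d <= k ->
  (forall st', at_arc d ps (arc p).1 p.+1 st' -> reaches st' T Q) ->
  reaches st (K + T) Q.
Proof.
move=> node le_d le_k next.
apply: (@reaches_le _ _ _ _ _ _ ((cost $rF + (8 + A)).+1 + T)); last first.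
  apply: reaches_step; first by case: node => [[[_ _ _ _ rFE] _ _ _] _]; rewrite /= rFE.
  have szE := size_inpE.
  apply: wp_if; wsimp; case: (node) => _ ->; split; first lia.
  split; first exact: ltn_bW.
  apply: bool_cases => // _; apply: wp_if; wsimp; case: (node) => _ ->.
  split; first lia; split; first exact: ltn_bW.
  apply: bool_cases => // _; apply: (wp_mono (backtrackP node le_d le_k)).
  by move=> t st' [le_t post]; split; [lia|apply: next].
by rewrite KE /=; lia.
Qed.

Lemma step_backtrack0 d st T Q : at_node 2 d [::] st -> d <= k ->
  (forall st', at_node 0 d.+1 [::] st' -> reaches st' T Q) ->
  reaches st (K + T) Q.
Proof.
move=> node le_k next.
apply: (@reaches_le _ _ _ _ _ _ ((cost $rF + (8 + A)).+1 + T)); last first.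
  apply: reaches_step; first by case: node => [[[_ _ _ _ rFE] _ _ _] _]; rewrite /= rFE.
  have szE := size_inpE.
  apply: wp_if; wsimp; case: (node) => _ ->; split; first lia.
  split; first exact: ltn_bW.
  apply: bool_cases => // _; apply: wp_if; wsimp; case: (node) => _ ->.
  split; first lia; split; first exact: ltn_bW.
  apply: bool_cases => // _; apply: (wp_mono (backtrack0P node le_k)).
  by move=> t st' [le_t post]; split; [lia|apply: next].
by rewrite KE /=; lia.
Qed.

Lemma count_drop_le (P : pred ('I_n * 'I_n)) p q :
  p <= q -> count P (drop q arcs) <= count P (drop p arcs).
Proof.
move=> le_pq; rewrite -{1}(subnK le_pq) -drop_drop.
by rewrite -{2}(cat_take_drop (q - p) (drop p arcs)) count_cat leq_addl.
Qed.

(** Failure only denies that the distance equals r; it does not say that the distance exceeds r.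
    This is enough: at budget k the initial distance is exactly k, which excludes failure, and a
    solution found at a smaller budget has at most k swaps anyway. *)
Definition result d ps r st : Prop :=
  found d st \/ at_node 2 d ps st /\ ~ distance_is (conf_of ps) r.

(** The first term pays for changing rows, the second for inspecting arcs out of misplaced vertices,
    and the third for the child of each candidate and the return from it. *)
Definition scan_cost c T u p : nat :=
  (n - u).+1 * K + count (fun uv => uv.1 \in misplaced c) (drop p arcs) * K +
  count (candidate c) (drop p arcs) * (T + 2 * K).

Lemma scan_cost_ge c T u p : K <= scan_cost c T u p.
Proof. by rewrite /scan_cost mulSn -!addnA leq_addr. Qed.

Lemma scan_cost_skip c T u p q : u < n -> p <= q ->
  K + scan_cost c T u.+1 q <= scan_cost c T u p.
Proof.
move=> lt_un le_pq; rewrite /scan_cost.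
have -> : n - u = (n - u.+1).+1 by lia.
rewrite (mulSn (n - u.+1).+1) !addnA.
apply: leq_add; first apply: leq_add => //.
  by rewrite leq_mul2r count_drop_le ?orbT.
by rewrite leq_mul2r count_drop_le ?orbT.
Qed.

Lemma scan_cost_next c T u p : p < size arcs -> (arc p).1 \in misplaced c ->
  K + candidate c (arc p) * (T + 2 * K) + scan_cost c T u p.+1 <= scan_cost c T u p.
Proof.
move=> lt_p mis; have dropE : drop p arcs = arc p :: drop p.+1 arcs by exact: drop_nth.
have cE (P : pred ('I_n * 'I_n)) :
    count P (drop p arcs) = P (arc p) + count P (drop p.+1 arcs) by rewrite dropE.
rewrite /scan_cost !cE mis !mulnDl mul1n.
have reorder a b x y : K + x + (a + b + y) <= a + (K + b) + (x + y) by lia.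
exact: reorder.
Qed.

(** Induction on the number of rows and arcs that remain. All candidates before [p] are known to
    have failed; since an optimal continuation would start with some candidate, a complete scan
    refutes distance r + 1. *)
Lemma scanP d ps r T :
  (forall p st, p < size arcs -> candidate (conf_of ps) (arc p) ->
     at_node 0 d (rcons ps p) st -> reaches st T (result d (rcons ps p) r)) ->
  size ps + r.+1 = d -> d <= k ->
  forall m u p st, (n - u) + (size arcs - p) < m -> at_arc d ps u p st ->
  (forall q, q < p -> candidate (conf_of ps) (arc q) ->
     ~ distance_is (swap (conf_of ps) (arc q)) r) ->
  reaches st (scan_cost (conf_of ps) T u p) (result d ps r.+1).
Proof.
set c := conf_of ps; move=> child sz_ps le_d.
have lt_d : size ps < d by lia.
elim=> [//|m IHm] u p st lt_m at_a failed.
have [_ _ _ le_u /andP[le_p lt_p]] := at_a.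
have off_size := offset_le_size adj u.+1.
have [lt_un|ge_un] := ltnP u n; last first.
  apply: reaches_le (scan_cost_ge c T u p) _; rewrite -[K]addn0.
  apply: step_advance at_a lt_d le_d _ => st'.
  rewrite ltnNge ge_un /= => node; apply: reaches_refl; right; split=> //.
  (* With no row left, the position is the end of [arcs], so every arc has been tried. *)
  case/distanceS=> q lt_q [cand_q dist_q]; apply: failed cand_q dist_q.
  have eq_un : u = n by lia.
  by apply: leq_trans lt_q _; rewrite -offset_size -eq_un.
have [lt_p'|ge_p'] := ltnP p (offset adj u.+1); last first.
  apply: reaches_le (scan_cost_skip c T lt_un (leqnn p)) _.
  apply: step_advance at_a lt_d le_d _ => st'; rewrite lt_un ltnNge ge_p' /= => at_a'.
  by apply: IHm at_a' failed; lia.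
have lt_pa : p < size arcs by exact: leq_trans lt_p' _.
have arc_u q : p <= q < offset adj u.+1 -> (arc q).1 = Ordinal lt_un.
  by move=> /andP[le_pq lt_q]; apply: nth_arcs; rewrite lt_q (leq_trans le_p).
have [mis|hap] := boolP ((arc p).1 \in misplaced c); last first.
  apply: reaches_le (scan_cost_skip c T lt_un (ltnW lt_p')) _.
  apply: step_advance at_a lt_d le_d _ => st'; rewrite lt_un lt_p' hap => at_a'.
  apply: (IHm _ _ _ _ at_a'); first lia.
  (* The skipped arcs share their first end, whose token is in place, so none of them is a
     candidate. *)
  move=> q lt_q; have [lt_qp|le_pq] := ltnP q p; first exact: failed.
  rewrite /candidate arc_u ?le_pq // -(arc_u p) ?leqnn //.
  by rewrite (negPf hap).
apply: reaches_le (scan_cost_next T u lt_pa mis) _.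
have [cand|Ncand] := boolP (candidate c (arc p)); last first.
  rewrite mul0n addn0; apply: step_advance at_a lt_d le_d _ => st'.
  rewrite lt_un lt_p' mis (negPf Ncand) /= => at_a'.
  apply: (IHm _ _ _ _ at_a'); first lia.
  move=> q; rewrite ltnS leq_eqVlt => /orP[/eqP->|]; last exact: failed.
  by rewrite (negPf Ncand).
set rest := scan_cost _ _ _ _; rewrite mul1n.
apply: (@reaches_le _ _ _ _ _ _ (K + (T + (K + rest)))); first lia.
apply: (step_advance at_a lt_d le_d) => st'; rewrite lt_un lt_p' mis cand /= => node.
apply: reaches_trans (child p st' lt_pa cand node) _ => st2 [fnd|[node2 Ndist]].
  by apply: reaches_refl; left.
apply: (step_backtrack node2 lt_d le_d) => st3.
have -> : ((arc p).1 : nat) = u by rewrite arc_u // leqnn.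
move=> at_a3; apply: IHm at_a3 _; first lia.
move=> q; rewrite ltnS leq_eqVlt => /orP[/eqP->|]; last exact: failed.
by move=> _; rewrite /conf_of /moves map_rcons play_rcons in Ndist.
Qed.

(** For a node with r swaps left, [b] r bounds the arcs inspected and [B] r the arcs tried. They
    become 2m and m for the edge bound, and 2 r Delta in both roles for the degree bound. The
    premise on misplaced vertices is what the pruning test of [enter] guarantees. *)
Variables b B : nat -> nat.
Hypothesis bP : forall c r, #|misplaced c| <= 2 * r.+1 ->
  count (fun uv => uv.1 \in misplaced c) arcs <= b r.+1.
Hypothesis BP : forall c r, #|misplaced c| <= 2 * r.+1 ->
  count (candidate c) arcs <= B r.+1.

Fixpoint node_cost r : nat :=
  if r is r'.+1 then n * K + ((n.+1 + b r) * K + B r * (node_cost r' + 2 * K))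
  else n * K.

Lemma nodeP r d ps st : size ps + r = d -> d <= k -> at_node 0 d ps st ->
  reaches st (node_cost r) (result d ps r).
Proof.
elim: r ps st => [|r IHr] ps st sz_ps le_d node.
  rewrite /= -[n * K]addn0.
  apply: (step_enter node) => [||st']; [lia|by []|].
  have -> : size ps == d by rewrite -sz_ps addn0.
  case: ifP => [mis0|mis0] inv; apply: reaches_refl; [left|right].
    by exists ps; split=> //; [rewrite -sz_ps addn0|apply/misplaced1P].
  split=> // /distance0 c1; move: mis0; rewrite c1.
  by rewrite (introT (misplaced1P _)).
apply: (step_enter node) => [||st']; [lia|by []|].
have -> : (size ps == d) = false by rewrite ltn_eqF //; lia.
have -> : d - size ps = r.+1 by lia.
case: ltnP => [lt_mis node2|le_mis at_a].
  apply: reaches_refl; right; split=> // /distance_misplaced; lia.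
apply: reaches_le; last first.
  apply: (scanP (r := r) (T := node_cost r) _ _ _ (ltnSn _) at_a) => //.
  by move=> p st2 _ _; apply: IHr; rewrite ?size_rcons; lia.
rewrite /scan_cost subn0 drop0 mulnDl; apply: leq_add.
  by apply: leq_add => //; rewrite leq_mul2r bP ?orbT.
by rewrite leq_mul2r BP ?orbT.
Qed.

(** Failure at a budget below k is not interpreted, it only leads to the next budget. Failure at
    budget k contradicts [dist_k]. *)
Lemma rootP e d st : distance_is (initial I) k -> d + e = k ->
  at_node 0 d [::] st ->
  reaches st (\sum_(d <= i < k.+1) (node_cost i + K))
    (fun st' => exists2 d', d' <= k & found d' st').
Proof.
move=> dist_k; elim: e d st => [|e IHe] d st dE node;
  (rewrite big_ltn; last lia); rewrite -addnA; apply: reaches_trans.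
- by apply: (nodeP (r := d)) node => //; lia.
- move=> st' [fnd|[_ []]]; last by have -> : d = k by lia.
  by apply: reaches_refl; exists d => //; lia.
- by apply: (nodeP (r := d)) node => //; lia.
- move=> st' [fnd|[node' _]]; first by apply: reaches_refl; exists d => //; lia.
  apply: (step_backtrack0 node') => [|st2 node2]; first lia.
  by apply: IHe node2; lia.
Qed.

Lemma emit_stackP d ps st : invariant 0 d ps st -> size ps = d -> d <= k ->
  wp emit_stack st (fun t st' => t <= 40 * d + 10 /\
    output st' = encode_swaps (moves ps)).
Proof.
case=> [[rNE rBE rDE _ _] stk _ outE] sz_ps le_d; have szE := size_inpE.
apply: wp_seq; apply: wp_assign; wsimp; split; first lia.
pose J i st' := [/\ i <= d, regs st' rI = i, work st' = work st,
  [/\ regs st' rN = n, regs st' rB = base & regs st' rD = d] &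
  output st' = encode_swaps (take i (moves ps))].
apply: (@wp_for _ _ _ J d 30).
- move=> i st1 [le_id rIE wkE [rNE1 rBE1 rDE1] outE1] lt_id.
  have lt_i : i < size ps by rewrite sz_ps.
  have [lt_p [wkU wkP]] := stk i lt_i; set p := nth 0 ps i in lt_p wkU wkP.
  wsimp; rewrite rIE rDE1 lt_id; split; first by split; lia.
  apply: wp_seq; apply: wp_emit; wsimp; rewrite rBE1 rIE wkE wkU.
  do 3![split; first lia].
  have vE : nth 0 inp (n + n + 2 + p) = (arc p).2.
    by rewrite (_ : n + n = 2 * n) ?(nth_encode_arc (v0, v0)) //; lia.
  apply: wp_seq; apply: wp_emit; wsimp; rewrite rNE1 rBE1 rIE ?wkE wkP vE.
  do 10![split; first lia].
  apply: wp_assign; wsimp; rewrite rIE; do 3![split; first lia].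
  split; wsimp => //; first exact: addn1.
  rewrite outE1 (take_nth (v0, v0)) ?size_map // (nth_map 0) //.
  by rewrite /encode_swaps map_rcons flatten_rcons -!cats1 -catA.
- by move=> st1 [_ rIE _ [_ _ rDE1] _]; wsimp; rewrite rIE rDE1 ltnn; split=> //; lia.
- by split=> //; wsimp; rewrite take0.
- move=> t st1 le_t [_ _ _ _ ->]; rewrite take_oversize ?size_map ?sz_ps //.
  by split=> //; move: le_t; wsimp; lia.
Qed.

Variables (init : cmd) (T0 : nat).

Hypothesis initP : forall st, regs st rN = n ->
  wp init st (fun t st' => [/\ t <= T0, regs st' rN = n /\ regs st' rB = base,
    conf_at (initial I) (work st') & output st' = output st]).

Lemma progP : initial I != 1%g -> distance_is (initial I) k ->
  wp (prog lookup apply init) start (fun t st' =>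
    t <= 22 * n + T0 + \sum_(1 <= i < k.+1) (node_cost i + K) + 40 * k + 60 /\
    exists2 s : seq ('I_n * 'I_n), output st' = encode_swaps s & optimal s).
Proof.
move=> init1 dist_k; have szE := size_inpE.
have k_gt0 : 0 < k.
  rewrite lt0n; apply/eqP => k0; move: dist_k; rewrite k0 => /distance0 c1.
  by rewrite c1 eqxx in init1.
apply: wp_seq; apply: (wp_mono (check_initialP leW start)).
move=> t1 st1 [le_t1 rNE rME _ outE]; apply: wp_if; wsimp; rewrite rME init1.
split=> // _; apply: wp_seq; apply: (wp_mono (initP rNE)).
move=> t2 st2 [le_t2 [rNE2 rBE2] cnf outE2].
do 4![apply: wp_seq; apply: wp_assign; wsimp; split; first lia].
apply: wp_seq; apply: wp_reaches.
- apply: (rootP (e := k.-1) (d := 1) dist_k); first lia.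
  split=> //; split=> //; wsimp; last by rewrite outE2 outE.
- move=> st3 [d _ [ps [[[_ _ _ _ rFE] _ _ _] _ _]]]; by wsimp.
move=> t3 st3 le_t3 [d le_d [ps [inv sz_ps c1]]].
apply: (wp_mono (emit_stackP inv sz_ps le_d)) => t4 st4 [le_t4 outE4].
split; first by move: le_t3; wsimp; lia.
exists (moves ps) => //; rewrite /optimal solvesE; split.
  apply/andP; split; last by apply/eqP.
  case: inv => _ stk _ _; apply/allP => _ /mapP[p /(nthP 0)[i lt_i <-] ->].
  by apply: arc_lt; case: (stk i lt_i).
move=> s'; rewrite solvesE size_map sz_ps; case: dist_k => w [_ _ min_w].
by move/min_w; apply: leq_trans.
Qed.

End Correctness.
(* The token of a vertex is found by undoing the swaps on the stack: there need
   not be enough cells for n tokens when k is small. *)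
Definition sparse_lookup : cmd :=
  rY ::= $rX;; 13 ::= $rJ;;
  While $13 (
    13 ::= $13 [-] #1;;
    14 ::= Work ($rB [+] $13 [+] $13);;
    15 ::= Input ($rN [+] $rN [+] #2 [+] Work ($rB [+] $13 [+] $13 [+] #1));;
    If ($rY [=] $14) (rY ::= $15) (If ($rY [=] $15) (rY ::= $14) Skip));;
  rY ::= Input (#1 [+] $rY).

Definition sparse_init : cmd := rB ::= #0.

Definition dense_lookup : cmd := rY ::= Work $rX.

Definition dense_apply : cmd :=
  13 ::= Work $rU;; Store $rU (Work $rV);; Store $rV $13.

Definition dense_init : cmd :=
  rB ::= $rN;; rI ::= #0;;
  While ($rI [<] $rN) (Store $rI (Input (#1 [+] $rI));; rI ::= $rI [+] #1).

(** * Tokens recomputed from the stack, and tokens kept in an array *)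

Section Representations.

Variable I : instance.
Local Notation n := (num_vertices I).
Variable adj : 'I_n -> seq 'I_n.
Local Notation inp := (encode adj).
Local Notation config := {perm 'I_n}.
Variables (W space k : nat).
Hypothesis leW : size inp + space < W.
Local Notation wp := (wp W space inp).

Definition no_conf (c : config) (wk : nat -> nat) : Prop := True.

Definition token_array (c : config) (wk : nat -> nat) : Prop :=
  forall v : 'I_n, wk v = c v.

Lemma sparse_lookupP ps st (x : 'I_n) : 2 * k <= space -> size ps <= k ->
  regs st rN = n -> regs st rB = 0 -> regs st rJ = size ps ->
  regs st rX = x -> stack_at adj 0 ps (work st) ->
  wp sparse_lookup st (fun t st' => [/\ t <= 50 * k.+1,
    forall r, r < 12 -> regs st' r = regs st r, regs st' rY = conf_of adj ps x,
    work st' = work st & output st' = output st]).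
Proof.
move=> le_space le_k rNE rBE rJE rXE stk; have szE := size_encode adj.
pose v0 : 'I_n := Ordinal (num_vertices_gt0 I).
apply: wp_seq; apply: wp_assign; wsimp; apply: wp_seq; apply: wp_assign; wsimp.
apply: wp_seq; rewrite rXE rJE.
(* The query is moved backwards through the swaps: the token at x after all of [ps] is the token at
   y after the first i of them. At i = 0 it can be read from the input. *)
pose J i st' := [/\ i <= size ps, forall r, r < 12 -> regs st' r = regs st r,
  regs st' 13 = i, exists2 y : 'I_n, regs st' rY = y &
    conf_of adj (take i ps) y = conf_of adj ps x &
  work st' = work st /\ output st' = output st].
apply: (@wp_while _ _ _ J (J 0) 45 (size ps)).
- move=> i st1 [le_i fr r13E [y rYE yE] [wkE outE]]; wsimp; rewrite r13E.
  split=> [i0|]; first by split=> //; [rewrite r13E|exists y; rewrite // -i0].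
  case: i le_i r13E yE => // i lt_i r13E yE _; exists i => //.
  have [lt_p [wkU wkP]] := stk i lt_i; set p := nth 0 ps i in lt_p wkU wkP.
  have frN : regs st1 rN = n by rewrite fr.
  have frB : regs st1 rB = 0 by rewrite fr.
  have vE : nth 0 inp (n + n + 2 + p) = (arc adj p).2.
    by rewrite (_ : n + n = 2 * n) ?(nth_encode_arc (v0, v0)) //; lia.
  have lt_v := ltn_ord (arc adj p).2; have lt_u := ltn_ord (arc adj p).1.
  have {}yE : conf_of adj (take i ps) (tperm (arc adj p).1 (arc adj p).2 y) =
      conf_of adj ps x.
    rewrite -yE (take_nth 0) // /conf_of /moves map_rcons play_rcons /swap permM.
    by [].
  apply: wp_seq; apply: wp_assign; wsimp; rewrite r13E subn1 /=.
  do 2![split; first lia].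
  apply: wp_seq; apply: wp_assign; wsimp; rewrite frB wkE wkU.
  do 3![split; first lia].
  apply: wp_seq; apply: wp_assign; wsimp; rewrite frN frB ?wkE wkP vE.
  do 10![split; first lia].
  have post z st2 : regs st2 rY = tperm (arc adj p).1 (arc adj p).2 y ->
    regs st2 13 = i -> (forall r, r < 12 -> regs st2 r = regs st1 r) ->
    work st2 = work st1 -> output st2 = output st1 -> z <= 45 -> z <= 45 /\ J i st2.
    move=> e1 e2 e3 e4 e5 e6; split=> //; split=> //; first exact: ltnW.
    - by move=> r lt_r; rewrite e3 ?fr.
    - by exists (tperm (arc adj p).1 (arc adj p).2 y).
    - by rewrite e4 e5.
  apply: wp_if; wsimp; rewrite rYE; split; first by case: (_ == _); lia.
  apply: bool_cases => yu.
    apply: wp_assign; wsimp; apply: post => //; wsimp => //.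
    - by rewrite (val_inj (eqP yu)) tpermL.
    - by move=> r lt_r; rewrite !setr_lt // (leq_trans lt_r).
  apply: wp_if; wsimp; rewrite rYE; split; first by case: (_ == _); lia.
  apply: bool_cases => yv.
    apply: wp_assign; wsimp; apply: post => //; wsimp => //.
    - by rewrite (val_inj (eqP yv)) tpermR.
    - by move=> r lt_r; rewrite !setr_lt // (leq_trans lt_r).
  apply: wp_skip; apply: post => //; wsimp => //.
  - by rewrite rYE tpermD // eq_sym; [apply: contra yu|apply: contra yv] => /eqP->.
  - by move=> r lt_r; rewrite !setr_lt // (leq_trans lt_r).
- split=> //; wsimp => //.
  + by move=> r lt_r; rewrite !setr_lt // (leq_trans lt_r).
  + by exists x; rewrite // take_size.
- move=> t st1 le_t [_ fr r13E [y rYE yE] [wkE outE]].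
  have lt_y := ltn_ord y.
  apply: wp_assign; wsimp; rewrite rYE; do 3![split; first lia].
  split; wsimp => //.
  + by move: le_t; wsimp; nia.
  + by move=> r lt_r; rewrite setr_lt ?fr // (leq_trans lt_r).
  + by rewrite nth_encode_token -yE take0.
Qed.

Lemma dense_lookupP c st (x : 'I_n) : n <= space ->
  regs st rX = x -> token_array c (work st) ->
  wp dense_lookup st (fun t st' => [/\ t <= 20,
    forall r, r < 12 -> regs st' r = regs st r, regs st' rY = c x,
    work st' = work st & output st' = output st]).
Proof.
move=> le_n rXE tok; have lt_x := ltn_ord x.
apply: wp_assign; wsimp; rewrite rXE tok; split; first lia; split; wsimp => //.
by move=> r lt_r; rewrite setr_lt.
Qed.

Lemma dense_applyP c st (u v : 'I_n) : n <= space ->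
  regs st rU = u -> regs st rV = v -> token_array c (work st) ->
  wp dense_apply st (fun t st' => [/\ t <= 20,
    forall r, r < 12 -> regs st' r = regs st r,
    forall a, n <= a -> work st' a = work st a,
    token_array (swap c (u, v)) (work st') & output st' = output st]).
Proof.
move=> le_n rUE rVE tok; have lt_u := ltn_ord u; have lt_v := ltn_ord v.
apply: wp_seq; apply: wp_assign; wsimp; rewrite rUE tok; split; first lia.
apply: wp_seq; apply: wp_store; wsimp; rewrite rUE rVE tok; do 2![split; first lia].
apply: wp_store; wsimp; rewrite rVE; split; first lia; split; wsimp => //.
- by move=> r lt_r; rewrite setr_lt // (leq_trans lt_r).
- by move=> a le_a; rewrite /update !gtn_eqF //; lia.
move=> x; rewrite /update /swap permM /=.
have -> : (x == v :> nat) = (x == v) by [].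
have -> : (x == u :> nat) = (x == u) by [].
by case: tpermP => [->|->|/eqP/negPf-> /eqP/negPf->]; rewrite ?eqxx ?tok //;
  case: eqP => // ->.
Qed.

Lemma dense_initP st : n <= space -> regs st rN = n ->
  wp dense_init st (fun t st' => [/\ t <= 20 * n + 20,
    regs st' rN = n /\ regs st' rB = n,
    token_array (initial I) (work st') & output st' = output st]).
Proof.
move=> le_n rNE; have szE := size_encode adj.
apply: wp_seq; apply: wp_assign; wsimp; apply: wp_seq; apply: wp_assign; wsimp.
split; first lia; rewrite rNE.
pose J i st' := [/\ i <= n, regs st' rI = i, regs st' rN = n /\ regs st' rB = n,
  forall v : 'I_n, v < i -> work st' v = initial I v & output st' = output st].
apply: (@wp_for _ _ _ J n 15).
- move=> i st1 [le_in rIE [rNE1 rBE1] wkE outE] lt_in; wsimp; rewrite rIE rNE1 lt_in.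
  split; first by split; lia.
  pose u := Ordinal lt_in.
  have tokE : nth 0 inp (1 + i) = initial I u by rewrite -(nth_encode_token adj).
  apply: wp_seq; apply: wp_store; wsimp; rewrite rIE tokE; do 4![split; first lia].
  apply: wp_assign; wsimp; rewrite rIE; do 3![split; first lia].
  split; wsimp => //; first exact: addn1.
  move=> v; rewrite /update ltnS leq_eqVlt => /orP[/eqP vu|lt_v].
    by rewrite vu eqxx; congr (val (initial I _)); apply: val_inj.
  by rewrite ltn_eqF // wkE.
- by move=> st1 [_ rIE [rNE1 _] _ _]; wsimp; rewrite rIE rNE1 ltnn; split=> //; lia.
- by split.
- move=> t st1 le_t [_ _ rs tok outE]; split=> //.
    by move: le_t; wsimp; lia.
  by move=> v; apply: tok.
Qed.

End Representations.

End Dfs.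

(** * Running times of the depth-first searches *)

Section Distance.

Variable I : instance.
Local Notation n := (num_vertices I).
Local Notation config := {perm 'I_n}.

Lemma min_swapsP : Dfs.distance_is (initial I) (min_swaps I).
Proof.
rewrite /min_swaps; case: ex_minnP => k /existsP[w w_sol] min_k; exists w; split.
- exact: size_tuple.
- by rewrite -solvesE.
- move=> w' w'_sorts; apply: min_k; apply/existsP; exists (in_tuple w').
  by rewrite solvesE.
Qed.

Lemma min_swaps_eq0 : initial I = 1%g -> min_swaps I = 0.
Proof.
move=> init1; case: min_swapsP => w [_ _ /(_ [::])].
by rewrite /sorts /= init1 eqxx leqn0 => /(_ isT)/eqP.
Qed.

Lemma min_swaps_gt0 : initial I != 1%g -> 0 < min_swaps I.
Proof.
move=> init1; rewrite lt0n; apply: contra init1 => /eqP k0.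
by apply/eqP/Dfs.distance0; rewrite -k0; apply: min_swapsP.
Qed.

Lemma num_vertices_gt1 : initial I != 1%g -> 1 < n.
Proof.
apply: contraR; rewrite -leqNgt => n_le1; apply/eqP/permP => v; apply: val_inj.
by rewrite perm1 /=; have := ltn_ord (initial I v); have := ltn_ord v; lia.
Qed.

(* With a single edge, two consecutive swaps cancel. *)
Lemma min_swaps_edge : num_edges I = 1 -> min_swaps I <= 1.
Proof.
move=> m1; case: min_swapsP => -[|t [|t' w]] [<- // + min_w].
case/andP=> /= /and3P[adj_t adj_t' adj_w] /eqP c_w.
pose g (uv : 'I_n * 'I_n) := if uv.1 < uv.2 then uv else (uv.2, uv.1).
pose E := [set uv : 'I_n * 'I_n | (uv.1 < uv.2) && adjacent uv.1 uv.2].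
have gE uv : adjacent uv.1 uv.2 -> g uv \in E.
  case: uv => u v; rewrite inE /g /= => auv; case: (ltnP u v) => [lt_uv|] /=.
    by rewrite lt_uv auv.
  rewrite leq_eqVlt adjacent_sym auv andbT => /orP[/eqP/val_inj vu|-> //].
  by rewrite vu adjacent_irr in auv.
have swapg c uv : swap c (g uv) = swap c uv.
  by case: uv => u v; rewrite /g; case: ifP => //= _; rewrite swap_sym.
have gtt' : g t = g t'.
  have /card_le1_eqP : #|E| <= 1 by rewrite -m1.
  by apply; apply: gE.
suff /min_w : sorts (initial I) w by rewrite /= ltnNge leqnSn.
rewrite /sorts adj_w /=; apply/eqP; rewrite -{}c_w /play /=; congr foldl.
by rewrite -[in RHS](swapg _ t') -gtt' swapg swapK.
Qed.

End Distance.

(** The programs only need words that hold every number up to the input length plus the number of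
    cells. An exponent above 1 provides them, as the input has more than one entry. *)
Lemma found_withinI (time space : instance -> nat) P c : 1 < c ->
  (forall I adj, @adjacency_lists I adj ->
    let cells := c * maxn 1 (space I) in
    forall W, size (encode adj) + cells < W ->
    wp W cells (encode adj) P start (fun t st => t <= c * maxn 1 (time I) /\
      exists2 s : seq ('I_(num_vertices I) * 'I_(num_vertices I)),
        output st = encode_swaps s & optimal s)) ->
  optimal_swaps_found_within time space.
Proof.
move=> c_gt1 PP; exists P, c => I adj adjP inp cells.
have W_gt : size inp + cells < (size inp + cells) ^ c.
  rewrite -[X in X < _]expn1 ltn_exp2l // size_encode.
  by have := num_vertices_gt0 I; lia.
have [t [st [Pst [le_t [s outE opt]]]]] := PP I adj adjP _ W_gt.
by exists t, st, s.
Qed.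

Lemma log2_gt0 n : 1 < n -> 0 < log2 n.
Proof. by move=> n_gt1; rewrite /log2 trunc_log_gt0. Qed.

Section GeometricSums.

Variables m k : nat.
(** If m = 1 the powers of m do not grow, and the bounds below survive only for k <= 1;
    [min_swaps_edge] provides this case. *)
Hypothesis mk : 1 < m \/ k <= 1.

Lemma geometric_sum : m * \sum_(0 <= i < k) m ^ i <= 2 * m ^ k.
Proof.
case: mk => [m_gt1|]; last first.
  case: k => [|[|//]] _; first by rewrite big_geq // muln0.
  by rewrite big_nat1 muln1 expn1 leq_pmull.
elim: k => [|j IHj]; first by rewrite big_geq // muln0.
by rewrite big_nat_recr //= mulnDr expnS; nia.
Qed.

Lemma leq_exp_self : 0 < m -> k <= m ^ k.
Proof.
move=> m_gt0; case: mk => [m_gt1|]; first exact/ltnW/ltn_expl.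
by case: k => [|[|//]].
Qed.

End GeometricSums.

Section EdgeBound.

Variables (I : instance) (m K : nat).
Local Notation n := (num_vertices I).
Hypotheses (n_gt1 : 1 < n) (le_n : n <= 2 * m).

Let cost := Dfs.node_cost I K (fun=> 2 * m) (fun=> m).

(** Apart from the recursive costs of its children, an inner node costs (2n + 1 + 4m)K, which is at
    most 9mK as n <= 2m. Unrolling the recursion gives the geometric sum; the first term pays nK for
    each of the m^r leaves. *)
Lemma node_cost_edges r :
  cost r <= n * K * m ^ r + 9 * K * (m * \sum_(0 <= i < r) m ^ i).
Proof.
elim: r => [|r IHr]; first by rewrite big_geq //= muln1 leq_addr.
have -> : \sum_(0 <= i < r.+1) m ^ i = 1 + m * \sum_(0 <= i < r) m ^ i.
  rewrite big_nat_recl // expn0 big_distrr /=; congr (_ + _).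
  by apply: eq_bigr => i _; rewrite expnS.
have IHm : m * cost r <=
    m * (n * K * m ^ r + 9 * K * (m * \sum_(0 <= i < r) m ^ i)).
  by rewrite leq_mul2l IHr orbT.
rewrite [cost _]/= -/(cost r) expnS; move: IHm.
move: (cost r) (m ^ r) (\sum_(_ <= _ < _) _) => x y z.
have : n * K <= 2 * m * K by rewrite leq_mul2r le_n orbT.
have : K <= m * K by rewrite leq_pmull //; lia.
nia.
Qed.

(** Budget i costs at most 11Kn m^i: nK for the leaves, 18K <= 9Kn for the inner nodes by
    [geometric_sum], and one more K, each relative to m^i. Summing over the budgets doubles the
    constant. *)
Lemma sum_node_cost_edges k : (1 < m \/ k <= 1) ->
  \sum_(1 <= i < k.+1) (cost i + K) <= 22 * K * n * m ^ k.
Proof.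
move=> mk; have m_gt0 : 0 < m by lia.
have costE i : i < k.+1 -> cost i + K <= 11 * K * n * m ^ i.
  move=> le_i; apply: leq_trans (leq_add (node_cost_edges i) (leqnn K)) _.
  have mi : 1 < m \/ i <= 1 by case: mk; [left|right; lia].
  have := geometric_sum mi; have : 0 < m ^ i by rewrite expn_gt0 m_gt0.
  move: (m ^ i) (m * \sum_(_ <= _ < _) _) => y z y_gt0 le_z.
  have : 9 * K * z <= 9 * K * (2 * y) by rewrite leq_mul2l le_z orbT.
  have : K * y * 2 <= K * y * n by rewrite leq_mul2l n_gt1 orbT.
  have : K <= K * y by rewrite leq_pmulr.
  nia.
rewrite big_nat_cond; apply: (@leq_trans (\sum_(1 <= i < k.+1) 11 * K * n * m ^ i)).
  rewrite [leqRHS]big_nat_cond; apply: leq_sum => i /andP[/andP[_ lt_i] _].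
  exact: costE.
rewrite -big_distrr /= big_add1 /=.
have -> : \sum_(0 <= i < k) m ^ i.+1 = m * \sum_(0 <= i < k) m ^ i.
  by rewrite big_distrr /=; apply: eq_bigr => i _; rewrite expnS.
have -> : 22 * K * n * m ^ k = 11 * K * n * (2 * m ^ k) by nia.
by rewrite leq_mul2l geometric_sum ?orbT.
Qed.

End EdgeBound.

Section DegreeBound.

Variables (I : instance) (Delta K : nat).
Local Notation n := (num_vertices I).
Hypothesis Delta_gt0 : 0 < Delta.

Let n_gt0 : 0 < n := num_vertices_gt0 I.

Let bound r := 2 * r * Delta.
Let cost := Dfs.node_cost I K bound bound.
Let N r := (2 * Delta) ^ r * r`!.

(** The added 9nK makes the induction close. With q = 2(r + 1)Delta >= 2, the step has to absorb
    12nK <= 6q nK and 3qK <= 3q nK, together exactly the 9q nK that the induction hypothesis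
    supplies. The base case gives the constant 10. *)
Lemma node_cost_degree r : cost r + 9 * (n * K) <= 10 * (n * K) * N r.
Proof.
elim: r => [|r IHr]; first by rewrite /N /= !muln1; lia.
have NE : N r.+1 = bound r.+1 * N r.
  by rewrite /N /bound expnS factS; nia.
have q_gt1 : 1 < bound r.+1 by rewrite /bound; nia.
rewrite NE [cost _]/= -/(cost r).
have IHq : bound r.+1 * (cost r + 9 * (n * K)) <= bound r.+1 * (10 * (n * K) * N r).
  by rewrite leq_mul2l IHr orbT.
move: IHq; move: (bound r.+1) (cost r) (N r) q_gt1 => q x y q_gt1.
have : K <= n * K by rewrite leq_pmull.
have : q * K <= q * (n * K) by rewrite leq_mul2l leq_pmull ?orbT.
have : 2 * (n * K) <= q * (n * K) by rewrite leq_mul2r q_gt1 orbT.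
nia.
Qed.

(** [N] at least doubles from one budget to the next, so the last budget accounts for at least half
    of the sum. *)
Lemma sum_node_cost_degree k :
  \sum_(1 <= i < k.+1) (cost i + K) <= 20 * (n * K) * N k.
Proof.
have costE i : cost i + K <= 10 * (n * K) * N i.
  apply: leq_trans (node_cost_degree i); rewrite leq_add2l.
  by rewrite mulnA leq_pmull //; lia.
apply: (@leq_trans (\sum_(1 <= i < k.+1) 10 * (n * K) * N i)).
  by apply: leq_sum => i _; apply: costE.
rewrite -big_distrr /= (_ : 20 * (n * K) * N k = 10 * (n * K) * (2 * N k)); last nia.
rewrite leq_mul2l; apply/orP; right.
elim: k => [|j IHj]; first by rewrite big_geq.
rewrite big_nat_recr //= /N expnS factS; move: IHj; rewrite /N.
move: (\sum_(_ <= _ < _) _) ((2 * Delta) ^ j) j`! => x y z le_x.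
have : 2 * (y * z) <= 2 * Delta * j.+1 * (y * z).
  by rewrite leq_mul2r; apply/orP; right; nia.
nia.
Qed.

End DegreeBound.

Lemma fact_leq_exp j M : j < M -> (j.+1)`! <= M ^ j.
Proof.
elim: j => [|j IHj] lt_j; first by [].
by rewrite factS expnS leq_mul // IHj // ltnW.
Qed.

(** The factor k + 1 is the order of the cost of a lookup through the stack. Since k + 1 <= 2k, it
    adds only a factor 2 to the estimate of k * k!. *)
Lemma succ_fact_leq Delta k :
  0 < k -> k.+1 * ((2 * Delta) ^ k * k`!) <= 2 * (2 * k * Delta) ^ k.
Proof.
case: k => // j _; have F : j.+1 * (j.+1)`! <= j.+1 ^ j.+1.
  by rewrite expnS leq_mul2l fact_leq_exp.
have -> : (2 * j.+1 * Delta) ^ j.+1 = (2 * Delta) ^ j.+1 * j.+1 ^ j.+1.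
  by rewrite -expnMn mulnAC.
move: F.
move: ((2 * Delta) ^ j.+1) (j.+1)`! (j.+1 ^ j.+1) => x y z le_y.
have : x * (j.+1 * y) <= x * z by rewrite leq_mul2l le_y orbT.
nia.
Qed.

Lemma divn_nlogn x n : 1 < n -> (x * n * log2 n) %/ (n * log2 n) = x.
Proof.
by move=> n_gt1; rewrite -mulnA mulnK // muln_gt0 log2_gt0 // andbT ltnW.
Qed.

Lemma edges_within :
  optimal_swaps_found_within
    (fun I => num_edges I ^ min_swaps I * num_vertices I * log2 (num_vertices I))
    (fun I => num_edges I ^ min_swaps I * num_vertices I * log2 (num_vertices I) %/
              (num_vertices I * log2 (num_vertices I))).
Proof.
(* Hides the numeral behind an inequality; the value is a generous bound on the constants collected
   below. *)
have [c le_c] : exists c, 200 * 100 <= c by exists (200 * 100).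
apply: (@found_withinI _ _
  (Dfs.prog Dfs.dense_lookup Dfs.dense_apply Dfs.dense_init) c); first lia.
move=> I adj adjP cells W leW; set n := num_vertices I; set m := num_edges I.
set k := min_swaps I; have [init1|init1] := eqVneq (initial I) 1%g.
  apply: (wp_mono (Dfs.prog_identityP leW _ _ _ init1)) => t st [le_t ?].
  split=> //; rewrite /k min_swaps_eq0 // mul1n.
  have := num_vertices_gt0 I; rewrite -/n => n_gt0.
  have [n_gt1|n_le1] := ltnP 1 n; last by rewrite -/n in le_t; nia.
  have : n <= n * log2 n by rewrite leq_pmulr ?log2_gt0.
  by rewrite -/n in le_t; nia.
have n_gt1 := num_vertices_gt1 init1; have k_gt0 := min_swaps_gt0 init1.
have le_n : n <= 2 * m.
  exact: leq_trans (leq_vertices_arcs adjP n_gt1) (size_arcs_leq adjP).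
have m_gt0 : 0 < m by lia.
have mk : 1 < m \/ k <= 1.
  have [|m_le1] := ltnP 1 m; [by left|right].
  by apply: min_swaps_edge; apply/eqP; rewrite eqn_leq m_le1.
have le_k := leq_exp_self mk m_gt0; have le_m : m <= m ^ k.
  by rewrite -{1}(expn1 m) leq_pexp2l.
have cellsE : cells = c * m ^ k.
  by rewrite /cells divn_nlogn // (maxn_idPr _) // expn_gt0 m_gt0.
(* Room for the token array, as n <= 2m <= 2m^k, and for the stack, as k <= m^k. *)
have le_space : n + 2 * k <= cells by rewrite cellsE; nia.
have le_nspace : n <= cells by lia.
(* If both ends are misplaced only the increasing direction is a candidate, and if one is, only the
   direction that starts there. *)
have cand_bound (c1 : {perm 'I_n}) r : #|misplaced c1| <= 2 * r.+1 ->
    count (Dfs.candidate c1) (arcs adj) <= m.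
  move=> _; apply: (count_arcs_asym adjP) => u v _; rewrite /Dfs.candidate /=.
  by case: (u \in _); case: (v \in _) => //=; rewrite -leqNgt => /ltnW.
have arc_bound (c1 : {perm 'I_n}) r : #|misplaced c1| <= 2 * r.+1 ->
    count (fun uv => uv.1 \in misplaced c1) (arcs adj) <= 2 * m.
  by move=> _; apply: leq_trans (count_size _ _) (size_arcs_leq adjP).
apply: (@wp_mono _ _ _ _ _ _ _ (Dfs.progP (tau := 20) adjP leW le_space
  (conf_at := @Dfs.token_array I) _ _ _ erefl erefl (b := fun=> 2 * m)
  (B := fun=> m) arc_bound cand_bound (T0 := 20 * n + 20) _ init1 (min_swapsP I))).
- move=> ps st x _ _ _ _ rXE _ tok.
  exact: (Dfs.dense_lookupP leW le_nspace rXE tok).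
- by move=> c1 st u v rUE rVE tok; apply: (Dfs.dense_applyP leW le_nspace rUE rVE tok).
- by move=> c1 wk wk' eq_wk tok v; rewrite eq_wk.
- by move=> st rNE; apply: (Dfs.dense_initP leW le_nspace rNE).
move=> t st [le_t ?]; split=> //.
set K := 3 * _ + 150 + 20 in le_t.
have := sum_node_cost_edges K n_gt1 le_n mk; move: le_t.
rewrite -/n -/m -/k.
move: (\sum_(_ <= _ < _) _) => S le_t le_S; apply: leq_trans le_t _.
rewrite (maxn_idPr _) ?muln_gt0 ?expn_gt0 ?m_gt0 ?log2_gt0 ?(ltnW n_gt1) //.
apply: (@leq_trans (c * (m ^ k * n))).
  apply: leq_trans (_ : _ <= 200 * 100 * (m ^ k * n)) _; first last.
    by rewrite leq_mul2r le_c orbT.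
  have : n <= m ^ k * n by rewrite leq_pmull // expn_gt0 m_gt0.
  have : m ^ k <= m ^ k * n by rewrite leq_pmulr // ltnW.
  have KE : K = 230 := erefl.
  rewrite KE in le_S; lia.
by rewrite leq_mul2l leq_pmulr ?orbT // log2_gt0.
Qed.

Lemma degree_within :
  optimal_swaps_found_within
    (fun I => (2 * min_swaps I * max_degree I) ^ min_swaps I *
              (num_vertices I * log2 (num_vertices I)))
    (fun I => (2 * min_swaps I * max_degree I) ^ min_swaps I *
              (num_vertices I * log2 (num_vertices I)) %/
              (num_vertices I * log2 (num_vertices I))).
Proof.
have [c le_c] : exists c, 200 * 100 <= c by exists (200 * 100).
apply: (@found_withinI _ _
  (Dfs.prog Dfs.sparse_lookup Skip Dfs.sparse_init) c); first lia.
move=> I adj adjP cells W leW; set n := num_vertices I; set Delta := max_degree I.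
set k := min_swaps I; have [init1|init1] := eqVneq (initial I) 1%g.
  apply: (wp_mono (Dfs.prog_identityP leW _ _ _ init1)) => t st [le_t ?].
  split=> //; rewrite /k min_swaps_eq0 // mul1n.
  have := num_vertices_gt0 I; rewrite -/n => n_gt0.
  have [n_gt1|n_le1] := ltnP 1 n; last by rewrite -/n in le_t; nia.
  have : n <= n * log2 n by rewrite leq_pmulr ?log2_gt0.
  by rewrite -/n in le_t; nia.
have n_gt1 := num_vertices_gt1 init1; have k_gt0 := min_swaps_gt0 init1.
have Delta_gt0 : 0 < Delta by exact: max_degree_gt0.
set X := (2 * k * Delta) ^ k.
have le_k : 2 * k <= X.
  apply: (@leq_trans (2 * k * Delta)); first by rewrite leq_pmulr.
  by rewrite -{1}(expn1 (2 * k * Delta)) leq_pexp2l // !muln_gt0 /= k_gt0.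
have cellsE : cells = c * X.
  by rewrite /cells mulnA divn_nlogn // (maxn_idPr _) // -/X; lia.
have le_space : 0 + 2 * k <= cells by rewrite cellsE; nia.
have arc_bound (c1 : {perm 'I_n}) r : #|misplaced c1| <= 2 * r.+1 ->
    count (fun uv => uv.1 \in misplaced c1) (arcs adj) <= 2 * r.+1 * Delta.
  move=> le_mis; apply: leq_trans (count_arcs_fst adjP _) _.
  by rewrite leq_mul2r le_mis orbT.
have cand_bound (c1 : {perm 'I_n}) r : #|misplaced c1| <= 2 * r.+1 ->
    count (Dfs.candidate c1) (arcs adj) <= 2 * r.+1 * Delta.
  move=> le_mis; apply: leq_trans (arc_bound c1 r le_mis); apply: sub_count.
  by move=> uv /andP[].
apply: (@wp_mono _ _ _ _ _ _ _ (Dfs.progP (tau := 50 * k.+1) adjP leW le_space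
  (conf_at := @Dfs.no_conf I) _ _ _ erefl erefl (b := fun r => 2 * r * Delta)
  (B := fun r => 2 * r * Delta) arc_bound cand_bound (T0 := 2) _ init1 (min_swapsP I))).
- move=> ps st x le_ps rNE rBE rJE rXE stk _.
  exact: (Dfs.sparse_lookupP leW le_space le_ps rNE rBE rJE rXE stk).
- by move=> c1 st u v _ _ _; apply: wp_skip; split.
- by [].
- by move=> st rNE; apply: wp_assign; wsimp; split; [lia|split].
move=> t st [le_t ?]; split=> //.
set K := 3 * _ + 150 + 20 in le_t.
have := sum_node_cost_degree I K Delta_gt0 k; move: le_t.
have := succ_fact_leq Delta k_gt0; rewrite -/X -/n -/k.
move: (\sum_(_ <= _ < _) _) ((2 * Delta) ^ k * k`!) => S N le_N le_t le_S.
apply: leq_trans le_t _.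
rewrite (maxn_idPr _) ?muln_gt0 ?log2_gt0 ?(ltnW n_gt1) ?andbT //; last by lia.
apply: (@leq_trans (c * (X * n))).
  apply: leq_trans (_ : _ <= 200 * 100 * (X * n)) _; first last.
    by rewrite leq_mul2r le_c orbT.
  have le_X : X <= X * n by rewrite leq_pmulr // ltnW.
  have le_nX : n <= X * n by rewrite leq_pmull //; lia.
  (* Here [tau] is 50(k + 1), so K is 150(k + 1) + 170. *)
  have le_K : K <= 320 * k.+1 by rewrite /K; lia.
  have le_KN : 20 * (n * K) * N <= 20 * 320 * 2 * (X * n).
    apply: (@leq_trans (20 * n * 320 * (k.+1 * N))); last nia.
    have : K * N <= 320 * k.+1 * N by rewrite leq_mul2r le_K orbT.
    nia.
  lia.
by rewrite leq_mul2l leq_mul2l leq_pmulr ?orbT // log2_gt0.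
Qed.

(** * Ranking of permutations in linear time *)

Section Ranking.

(* Myrvold and Ruskey's linear-time ranking: a lists the L tokens that have
   not occurred yet and pos inverts a; the position of the next token is a
   digit in base L, and the last available token takes its place. *)
Fixpoint rank (a pos : nat -> nat) L (cs : seq nat) r : nat :=
  if cs is c :: cs' then
    rank (update a (pos c) (a L.-1)) (update pos (a L.-1) (pos c)) L.-1 cs'
      (r * L + pos c)
  else r.

Definition rankable (a pos : nat -> nat) L (cs : seq nat) : Prop :=
  [/\ forall i, i < L -> pos (a i) = i, uniq cs, size cs = L &
      forall c, c \in cs -> exists2 i, i < L & a i = c].

Lemma rankable_head a pos L c cs : rankable a pos L (c :: cs) ->
  pos c < L /\ a (pos c) = c.
Proof.
case=> posK _ _ /(_ c (mem_head _ _))[i lt_i ai].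
by rewrite -ai posK.
Qed.

Lemma rankable_step a pos L c cs : rankable a pos L (c :: cs) ->
  rankable (update a (pos c) (a L.-1)) (update pos (a L.-1) (pos c)) L.-1 cs.
Proof.
move=> ok; have [lt_p ac] := rankable_head ok.
case: ok => posK /= /andP[c_cs uniq_cs] sz_cs mem_cs.
have L_gt0 : L.-1 < L by lia.
split=> //.
- move=> i lt_i; have lt_iL : i < L by lia.
  have neq_a : i != L.-1 -> a i != a L.-1.
    by apply: contraNneq => /(congr1 pos); rewrite !posK // => ->.
  rewrite /update; case: (i =P pos c) => [->|_]; first by rewrite eqxx.
  by rewrite (negPf (neq_a _)) ?posK // ltn_eqF.
- lia.
- move=> c' c'_cs; have [|i lt_i ai] := mem_cs c'; first by rewrite inE c'_cs orbT.
  have neq_i : i != pos c.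
    by apply/eqP => iE; move: c_cs; rewrite -ac -iE ai c'_cs.
  have [iL|neq_iL] := eqVneq i L.-1; last first.
    by exists i; [lia|rewrite /update (negPf neq_i)].
  by exists (pos c); [lia|rewrite /update eqxx -iL].
Qed.

Lemma fact_pred L : 0 < L -> L`! = L * (L.-1)`!.
Proof. by case: L => // L _; rewrite factS. Qed.

(** The digits form a mixed radix numeral with bases L, L - 1, ..., 1. *)
Lemma rank_lt a pos L cs r : rankable a pos L cs -> rank a pos L cs r < r.+1 * L`!.
Proof.
elim: cs a pos L r => [|c cs IHcs] a pos L r ok.
  by case: ok => _ _ <- _; rewrite muln1 /=.
have [lt_p _] := rankable_head ok.
have L_gt0 : 0 < L by lia.
apply: leq_trans (IHcs _ _ _ _ (rankable_step ok)) _.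
rewrite (fact_pred L_gt0) mulnA leq_mul2r.
by rewrite mulSn; apply/orP; right; lia.
Qed.

(** The conclusion has two stages because information flows in two directions. Remainders and
    quotients recover the digits from the last to the first, without knowing the arrays. Equal
    arrays then turn equal digits into equal tokens from the first to the last. *)
Lemma rank_inj a pos a' pos' L cs cs' r r' :
  rankable a pos L cs -> rankable a' pos' L cs' ->
  rank a pos L cs r = rank a' pos' L cs' r' ->
  r = r' /\ (a = a' -> cs = cs').
Proof.
elim: cs cs' a pos a' pos' L r r' => [|c cs IHcs] [|c' cs'] a pos a' pos' L r r' ok ok'.
- by [].
- by case: ok => _ _ sz _; case: ok' => _ _ sz' _; rewrite -sz in sz'.
- by case: ok => _ _ sz _; case: ok' => _ _ sz' _; rewrite -sz in sz'.
have [lt_p ac] := rankable_head ok; have [lt_p' ac'] := rankable_head ok'.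
move/(IHcs _ _ _ _ _ _ _ _ (rankable_step ok) (rankable_step ok')) => [eq_r eq_cs].
have L_gt0 : 0 < L by lia.
have eq_p : pos c = pos' c'.
  by have := congr1 (modn^~ L) eq_r; rewrite !modnMDl !modn_small.
have {}eq_r : r = r'.
  by have := congr1 (divn^~ L) eq_r; rewrite !divnMDl // !divn_small ?addn0.
split=> // eq_a; congr (_ :: _); first by rewrite -ac -ac' eq_a eq_p.
by apply: eq_cs; rewrite eq_a eq_p.
Qed.

End Ranking.

Section ConfigRank.

Variable I : instance.
Local Notation n := (num_vertices I).
Implicit Type c : {perm 'I_n}.

Definition tokens c : seq nat := [seq val (c v) | v <- enum 'I_n].

Definition config_rank c : nat := rank id id n (tokens c) 0.

Lemma size_tokens c : size (tokens c) = n.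
Proof. by rewrite size_map size_enum_ord. Qed.

Lemma nth_tokens c (v : 'I_n) : nth 0 (tokens c) v = c v.
Proof. by rewrite (nth_map v) ?size_enum_ord // nth_ord_enum. Qed.

Lemma rankable_tokens c : rankable id id n (tokens c).
Proof.
split=> //; last by move=> _ /mapP[v _ ->]; exists (c v).
  by rewrite map_inj_uniq ?enum_uniq // => u v /val_inj/perm_inj.
exact: size_tokens.
Qed.

Lemma config_rank_lt c : config_rank c < n`!.
Proof. by rewrite -[n`!]mul1n; apply/rank_lt/rankable_tokens. Qed.

Lemma config_rank_inj : injective config_rank.
Proof.
move=> c c' /(rank_inj (rankable_tokens c) (rankable_tokens c'))[_ /(_ erefl) eq_t].
by apply/permP => v; apply: val_inj; rewrite /= -!nth_tokens eq_t.
Qed.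

End ConfigRank.

(** * Breadth-first search from the identity *)

Section BreadthFirst.

Variable I : instance.
Local Notation n := (num_vertices I).
Local Notation word := (seq ('I_n * 'I_n)).
Local Notation config := {perm 'I_n}.
Local Notation node := (config * word)%type.

Implicit Types (Q : seq node) (c : config).

Definition bfs_root : node := (1%g, [::]).

Local Notation conf Q i := (nth bfs_root Q i).1.
Local Notation path Q i := (nth bfs_root Q i).2.

Definition insert_node Q (x : node) : seq node :=
  if x.1 \in [seq y.1 | y <- Q] then Q else rcons Q x.

Definition reached Q c l : Prop :=
  exists j, [/\ j < size Q, conf Q j = c & size (path Q j) <= l].

Definition expanded Q i : Prop := forall uv, adjacent uv.1 uv.2 ->
  reached Q (swap (conf Q i) uv) (size (path Q i)).+1.

(** Nodes are never removed: [h] is the head and the nodes before it stay in the list. The last two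
    clauses say that path lengths are nondecreasing and exceed that of the head by at most one. *)
Definition bfs_queue Q h : Prop :=
  [/\ 0 < size Q /\ nth bfs_root Q 0 = bfs_root, uniq [seq x.1 | x <- Q],
      forall i, i < size Q -> sorts (conf Q i) (path Q i),
      forall i j, i <= j < size Q -> size (path Q i) <= size (path Q j) &
      forall i, i < size Q -> size (path Q i) <= (size (path Q h)).+1].

Definition bfs_inv Q h : Prop :=
  [/\ bfs_queue Q h, h < size Q &
      forall i, i < h -> conf Q i != initial I /\ expanded Q i].

Definition extends Q Q' : Prop :=
  size Q <= size Q' /\ forall i, i < size Q -> nth bfs_root Q' i = nth bfs_root Q i.

Lemma extends_trans Q1 Q2 Q3 : extends Q1 Q2 -> extends Q2 Q3 -> extends Q1 Q3.
Proof.
move=> [le12 eq12] [le23 eq23]; split; first exact: leq_trans le23.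
by move=> i lt_i; rewrite eq23 ?eq12 // (leq_trans lt_i).
Qed.

Lemma extends_insert Q x : extends Q (insert_node Q x).
Proof.
rewrite /insert_node; case: ifP => // _; split; first by rewrite size_rcons.
by move=> i lt_i; rewrite nth_rcons lt_i.
Qed.

Lemma extends_reached Q Q' c l : extends Q Q' -> reached Q c l -> reached Q' c l.
Proof.
move=> [le_sz eqQ] [j [lt_j cj le_l]]; exists j; rewrite eqQ //; split=> //.
exact: leq_trans le_sz.
Qed.

Lemma extends_expanded Q Q' i : i < size Q ->
  extends Q Q' -> expanded Q i -> expanded Q' i.
Proof.
move=> lt_i ext exp_i uv adj_uv; have [_ eqQ] := ext.
by rewrite eqQ //; apply: extends_reached ext _; apply: exp_i.
Qed.

Lemma size_bfs_queue Q h : bfs_queue Q h -> size Q <= n`!.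
Proof.
case=> _ uniqQ _ _ _; rewrite -(size_map fst) -(card_uniqP uniqQ) -card_Sn.
exact: max_card.
Qed.

Lemma bfs_insert Q h uv (x := (swap (conf Q h) uv, uv :: path Q h)) :
  bfs_queue Q h -> h < size Q -> adjacent uv.1 uv.2 ->
  bfs_queue (insert_node Q x) h /\
  reached (insert_node Q x) (swap (conf Q h) uv) (size (path Q h)).+1.
Proof.
case=> [[Q_gt0 Q0] uniqQ sortQ monoQ boundQ] lt_h adj_uv.
rewrite /insert_node; case: ifP => [/(nthP 1%g)[j]|x_Q].
  rewrite size_map => lt_j; rewrite (nth_map bfs_root) //= => cj.
  (* A configuration already in the queue has a short enough path, since no path is longer than that
     of the head by more than one. *)
  by split=> //; exists j; split=> //; apply: boundQ.
have nthS i : i < size Q -> nth bfs_root (rcons Q x) i = nth bfs_root Q i.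
  by move=> lt_i; rewrite nth_rcons lt_i.
have nthx : nth bfs_root (rcons Q x) (size Q) = x by rewrite nth_rcons ltnn eqxx.
split; last first.
  by exists (size Q); rewrite nthx size_rcons.
split=> //.
- by rewrite size_rcons nthS.
- by rewrite map_rcons rcons_uniq x_Q.
- move=> i; rewrite size_rcons ltnS leq_eqVlt => /orP[/eqP->|lt_i].
    rewrite nthx /=; have /andP[adj_h play_h] := sortQ h lt_h.
    by rewrite /sorts /= adj_uv adj_h /play /= swapK.
  by rewrite nthS ?sortQ.
- move=> i j; rewrite size_rcons ltnS => /andP[le_ij].
  rewrite leq_eqVlt => /orP[/eqP jE|lt_j]; last first.
    by rewrite !nthS ?monoQ ?le_ij ?(leq_ltn_trans le_ij).
  move: le_ij; rewrite jE nthx /= leq_eqVlt => /orP[/eqP->|lt_i].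
    by rewrite nthx.
  by rewrite nthS ?boundQ.
- move=> i; rewrite size_rcons ltnS leq_eqVlt => /orP[/eqP->|lt_i].
    by rewrite nthx nthS.
  by rewrite !nthS ?boundQ.
Qed.

(* Nodes from h on have paths longer than l, so all the nodes met while following
   a sorting sequence of length at most l backwards have been expanded. *)
Lemma bfs_complete Q h0 h : bfs_queue Q h0 ->
  (forall i, i < h -> conf Q i != initial I /\ expanded Q i) -> h <= size Q ->
  forall l, (forall j, h <= j -> j < size Q -> l < size (path Q j)) ->
  forall w c, size w <= l -> sorts c w -> reached Q c (size w).
Proof.
case=> [[Q_gt0 Q0] _ _ _ _] expQ le_h l far.
elim=> [|uv w IHw] c /= lt_w /andP[/= adj_w /eqP play_w].
  by exists 0; rewrite Q0.
case/andP: adj_w => adj_uv adj_w.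
have [||j [lt_j cj le_j]] := IHw (swap c uv); first exact: ltnW.
  by rewrite /sorts adj_w; apply/eqP.
have lt_jh : j < h.
  rewrite ltnNge; apply/negP => le_hj.
  by have := far j le_hj lt_j; rewrite ltnNge (leq_trans le_j) // ltnW.
have [_ /(_ uv adj_uv)] := expQ j lt_jh.
rewrite cj swapK => -[i [lt_i ci le_i]].
by exists i; split=> //; apply: leq_trans le_i _.
Qed.

(** The point is that the queue does not run out. If it did, all nodes would be expanded and
    [bfs_complete] would apply with an empty set of far nodes. The initial configuration, which can
    be sorted, would then be among them, against the assumption that all of them differ from it. *)
Lemma bfs_next Q Q' h : bfs_inv Q h -> conf Q h != initial I -> extends Q Q' ->
  bfs_queue Q' h -> expanded Q' h -> bfs_inv Q' h.+1.
Proof.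
move=> [okQ lt_h expQ] not_init ext okQ' exp_h; have [le_sz eqQ] := ext.
have expQ' i : i < h.+1 -> conf Q' i != initial I /\ expanded Q' i.
  rewrite ltnS leq_eqVlt => /orP[/eqP->|lt_i]; first by rewrite eqQ.
  have lt_iQ := ltn_trans lt_i lt_h.
  have [ni exp_i] := expQ i lt_i; rewrite eqQ //; split=> //.
  exact: extends_expanded exp_i.
have lt_h' : h.+1 < size Q'.
  rewrite ltnNge; apply/negP => le_sz'.
  have le_h' : h.+1 <= size Q' by exact: leq_trans le_sz.
  have [w [_ sorts_w _]] := min_swapsP I.
  have [|j [lt_j cj _]] :=
      bfs_complete (l := size w) okQ' expQ' le_h' _ (leqnn _) sorts_w.
    by move=> j le_j lt_j; have := leq_trans lt_j le_sz'; rewrite ltnNge le_j.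
  by have [] := expQ' j (leq_trans lt_j le_sz'); rewrite cj eqxx.
split=> //; case: okQ' => Q0 uniqQ sortQ monoQ boundQ; split=> //.
move=> i lt_i; apply: leq_trans (boundQ i lt_i) _; rewrite ltnS.
by apply: monoQ; rewrite leqnSn.
Qed.

(** A shorter sorting sequence would put the initial configuration before the head by
    [bfs_complete], but the nodes there differ from it. *)
Lemma bfs_optimal Q h : bfs_inv Q h -> conf Q h = initial I -> optimal (path Q h).
Proof.
move=> [okQ lt_h expQ] ch; have [_ _ sortQ monoQ _] := okQ.
split; first by rewrite solvesE -ch sortQ.
move=> w; rewrite solvesE => sorts_w; rewrite leqNgt; apply/negP => lt_w.
have [|j [lt_j cj le_j]] :=
    bfs_complete (l := size w) okQ expQ (ltnW lt_h) _ (leqnn _) sorts_w.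
  by move=> j le_j lt_j; apply: leq_trans lt_w _; apply: monoQ; rewrite le_j.
have lt_jh : j < h.
  rewrite ltnNge; apply/negP => le_hj; move: lt_w.
  by rewrite ltnNge (leq_trans _ le_j) // monoQ // le_hj.
by have [] := expQ j lt_jh; rewrite cj eqxx.
Qed.

Lemma bfs_init : bfs_inv [:: bfs_root] 0.
Proof.
split=> //; split=> //.
- by case=> // _; rewrite /sorts /play /=.
- by case=> // -[].
- by case.
Qed.

End BreadthFirst.

(** * Breadth-first search on the word RAM *)

Module Bfs.

(* rH and rT are the head and the size of the queue, rU and rP a vertex and a
   position in the concatenated adjacency lists; rG tells if the configuration at
   the head of the queue differs from the initial one. *)
Notation rN := 0.
Notation rH := 1.
Notation rT := 2.
Notation rU := 3.
Notation rP := 4.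
Notation rV := 5.
Notation rG := 6.
Notation rA := 7.
Notation rB := 8.
Notation rI := 9.
Notation rL := 10.
Notation rC := 11.
Notation rQ := 12.
Notation rX := 13.
Notation rR := 14.

(* Cells 0, ..., 2n - 1 are the scratch arrays of the ranking.  Then come slots
   of n + 4 cells: slot i holds the tokens of the i-th node of the queue, the
   index of its parent and the two ends of the swap that leads to the parent;
   the last cell tells if the configuration of rank i is in the queue. *)
Definition slot_addr (x : nat) : expr := $rN [+] $rN [+] $x [*] ($rN [+] #4).

Definition rank_slot : cmd :=
  rI ::= #0;;
  While ($rI [<] $rN) (Store $rI $rI;; Store ($rN [+] $rI) $rI;; rI ::= $rI [+] #1);;
  rI ::= #0;; rR ::= #0;;
  While ($rI [<] $rN) (
    rC ::= Work ($rA [+] $rI);; rL ::= $rN [-] $rI;;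
    rQ ::= Work ($rN [+] $rC);; rX ::= Work ($rL [-] #1);;
    Store $rQ $rX;; Store ($rN [+] $rX) $rQ;;
    rR ::= $rR [*] $rL [+] $rQ;; rI ::= $rI [+] #1).

Definition insert : cmd :=
  rA ::= slot_addr rT;; rank_slot;; rA ::= slot_addr rR;;
  If (Work ($rA [+] $rN [+] #3)) Skip
    (Store ($rA [+] $rN [+] #3) #1;; rT ::= $rT [+] #1).

Definition copy_swapped : cmd :=
  rA ::= slot_addr rT;; rB ::= slot_addr rH;; rI ::= #0;;
  While ($rI [<] $rN) (Store ($rA [+] $rI) (Work ($rB [+] $rI));; rI ::= $rI [+] #1);;
  Store ($rA [+] $rU) (Work ($rB [+] $rV));; Store ($rA [+] $rV) (Work ($rB [+] $rU));;
  Store ($rA [+] $rN) $rH;; Store ($rA [+] $rN [+] #1) $rU;;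
  Store ($rA [+] $rN [+] #2) $rV.

Definition expand : cmd :=
  rU ::= #0;; rP ::= #0;;
  While ($rU [<] $rN) (
    If ($rP [<] Input ($rN [+] $rU [+] #2))
      (rV ::= Input ($rN [+] $rN [+] #2 [+] $rP);;
       If ($rU [<] $rV) (copy_swapped;; insert) Skip;;
       rP ::= $rP [+] #1)
      (rU ::= $rU [+] #1)).

Definition compare : cmd :=
  rG ::= #0;; rB ::= slot_addr rH;; rI ::= #0;;
  While ($rI [<] $rN) (
    If (Work ($rB [+] $rI) [=] Input (#1 [+] $rI)) Skip (rG ::= #1);;
    rI ::= $rI [+] #1).

Definition emit_path : cmd :=
  While $rH (
    rB ::= slot_addr rH;;
    Emit (Work ($rB [+] $rN [+] #1));; Emit (Work ($rB [+] $rN [+] #2));;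
    rH ::= Work ($rB [+] $rN)).

Definition prog : cmd :=
  rN ::= Input #0;; rI ::= #0;;
  While ($rI [<] $rN) (Store ($rN [+] $rN [+] $rI) $rI;; rI ::= $rI [+] #1);;
  rT ::= #0;; insert;; rH ::= #0;; compare;;
  While $rG (expand;; rH ::= $rH [+] #1;; compare);;
  emit_path.

Section Correctness.

Variable I : instance.
Local Notation n := (num_vertices I).
Variable adj : 'I_n -> seq 'I_n.
Hypothesis adjP : adjacency_lists adj.
Local Notation inp := (encode adj).
Local Notation arcs := (arcs adj).
Local Notation config := {perm 'I_n}.
Local Notation node := (config * seq ('I_n * 'I_n))%type.

Definition slot i := 2 * n + i * (n + 4).

Variables (W space : nat).
Hypothesis leW : size inp + space < W.
Hypothesis le_space : slot n`!.+1 <= space.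

Local Notation wp := (wp W space inp).
Local Notation conf Q i := (nth (bfs_root I) Q i).1.
Local Notation path Q i := (nth (bfs_root I) Q i).2.

Let v0 : 'I_n := Ordinal (num_vertices_gt0 I).

(** Slot n! is included: a neighbour is written behind the queue, which may already be full, before
    it is known whether it is new. *)
Lemma slot_lt i x : i <= n`! -> x < n + 4 -> slot i + x < space.
Proof.
move=> le_i lt_x; apply: leq_trans le_space.
have : i.+1 * (n + 4) <= n`!.+1 * (n + 4) by rewrite leq_mul2r ltnS le_i orbT.
rewrite /slot mulSn; lia.
Qed.

Lemma slot_lt_n3 i : i <= n`! -> slot i + (n + 3) < space.
Proof. by move=> le_i; apply: slot_lt => //; rewrite ltn_add2l. Qed.

Lemma fact_lt_space : n`! < space.
Proof.
apply: leq_trans le_space; rewrite /slot -[leqLHS]muln1.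
by apply: leq_trans (leq_addl _ _); rewrite leq_mul2l addn4.
Qed.

Lemma slot_neq i j x y : i != j -> x < n + 4 -> y < n + 4 -> slot i + x != slot j + y.
Proof.
have lt_slot i' j' x' y' : i' < j' -> x' < n + 4 -> slot i' + x' < slot j' + y'.
  move=> lt_ij lt_x; have : i'.+1 * (n + 4) <= j' * (n + 4).
    by rewrite leq_mul2r lt_ij orbT.
  rewrite /slot mulSn; lia.
rewrite neq_ltn => /orP[lt_ij|lt_ji] lt_x lt_y; first by rewrite ltn_eqF ?lt_slot.
by rewrite gtn_eqF ?lt_slot.
Qed.

Lemma slot_ge i : 2 * n <= slot i. Proof. exact: leq_addr. Qed.

Lemma wp_slot x r i st (Q : nat -> state -> Prop) :
  regs st rN = n -> regs st r = i -> i <= n`! ->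
  Q 10 (State (setr (regs st) x (slot i)) (work st) (output st)) ->
  wp (x ::= slot_addr r) st Q.
Proof.
move=> rNE rE le_i Qst; have := slot_lt le_i (ltn_addl n (ltn0Sn 3)).
have slotE : n + n + i * (n + 4) = slot i by rewrite /slot mul2n addnn.
have szE := size_encode adj; have n_gt0 := num_vertices_gt0 I.
rewrite addn0 -slotE => lt_slot; apply: wp_assign; rewrite /slot_addr; wsimp.
rewrite rNE rE; move: Qst; rewrite -slotE; move: (i * (n + 4)) lt_slot => m lt_m Qm.
by do 5![split; first lia].
Qed.

Lemma rank_slotP (c : config) st a : regs st rN = n -> regs st rA = a -> 2 * n <= a ->
  a + n <= space -> (forall v : 'I_n, work st (a + v) = c v) ->
  wp rank_slot st (fun t st' => [/\ t <= 80 * n + 20,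
    forall r, r < 8 -> regs st' r = regs st r, regs st' rR = config_rank c,
    forall x, 2 * n <= x -> work st' x = work st x & output st' = output st]).
Proof.
move=> rNE rAE le_a le_space_a tok; have szE := size_encode adj.
have n_gt0 := num_vertices_gt0 I.
apply: wp_seq; apply: wp_assign; wsimp; split; first lia.
apply: wp_seq.
pose J i st' := [/\ i <= n, regs st' rI = i, forall r, r < 8 -> regs st' r = regs st r,
  forall x, x < i -> work st' x = x /\ work st' (n + x) = x &
  (forall x, 2 * n <= x -> work st' x = work st x) /\ output st' = output st].
apply: (@wp_for _ _ _ J n 20).
- move=> i st1 [le_in rIE fr arr [wkE outE]] lt_in; wsimp.
  have rN1 : regs st1 rN = n by rewrite fr.
  rewrite rIE rN1 lt_in; split; first by split; lia.
  apply: wp_seq; apply: wp_store; wsimp; rewrite rIE; split; first lia.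
  apply: wp_seq; apply: wp_store; wsimp; rewrite rN1 rIE; do 2![split; first lia].
  apply: wp_assign; wsimp; rewrite rIE; do 3![split; first lia].
  split; wsimp => //; first exact: addn1.
  + by move=> r lt_r; rewrite setr_lt ?fr // (leq_trans lt_r).
  + move=> x; rewrite ltnS leq_eqVlt /update => /orP[/eqP->|lt_x].
      by rewrite !eqxx ltn_eqF //; lia.
    have [e1 e2] := arr x lt_x.
    by do 4![case: eqP => [?|_]; first lia].
  + by split=> // x le_x; rewrite /update !gtn_eqF ?wkE //; lia.
- move=> st1 [_ rIE fr _ _]; wsimp; rewrite rIE fr // rNE ltnn; split=> //; lia.
- split=> //; move=> r lt_r; wsimp; rewrite setr_lt // (leq_trans lt_r) //.
move=> t1 st1 le_t1 [_ _ fr1 arr1 [wkE1 outE1]]; move: le_t1; wsimp => le_t1.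
do 2![apply: wp_seq; apply: wp_assign; wsimp; split; first lia].
(* The arrays in memory agree below n with [av] and [pos], and finishing the ranking from here
   yields [config_rank] c. The inequality with factorials keeps every partial rank below n!, so that
   it fits in a word. *)
pose J2 i st' := [/\ i <= n, regs st' rI = i, forall r, r < 8 -> regs st' r = regs st r,
  exists av pos r, [/\ rankable av pos (n - i) (drop i (tokens c)),
    rank av pos (n - i) (drop i (tokens c)) r = config_rank c,
    r.+1 * (n - i)`! <= n`!, regs st' rR = r &
    forall x, x < n -> [/\ av x < n, work st' x = av x & work st' (n + x) = pos x]] &
  (forall x, 2 * n <= x -> work st' x = work st x) /\ output st' = output st].
apply: (@wp_for _ _ _ J2 n 40).
- move=> i st2 [le_in rIE fr [av [pos [r [ok rankE le_r rRE arr]]]] [wkE outE]] lt_in.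
  wsimp; have rN2 : regs st2 rN = n by rewrite fr.
  have rA2 : regs st2 rA = a by rewrite fr.
  rewrite rIE rN2 lt_in; split; first by split; lia.
  pose u := Ordinal lt_in.
  have dropE : drop i (tokens c) = val (c u) :: drop i.+1 (tokens c).
    by rewrite (drop_nth 0) ?size_tokens // (nth_tokens c u).
  rewrite dropE in ok rankE.
  have [lt_p ac] := rankable_head ok; have lt_c := ltn_ord (c u).
  set p := pos (c u) in lt_p ac *.
  have lt_fact := fact_lt_space.
  have le_rp : r * (n - i) + p < n`!.
    apply: leq_trans le_r; rewrite (@fact_pred (n - i)) ?mulnA; last lia.
    have := fact_gt0 (n - i).-1; nia.
  have lt_rpW : r * (n - i) + p < W by apply: leq_trans le_rp _; lia.
  have lt_rW := leq_ltn_trans (leq_addr p _) lt_rpW.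
  have [lt_x wkX _] := arr (n - i).-1 ltac:(lia).
  have [_ _ wkQ] := arr (c u) lt_c.
  apply: wp_seq; apply: wp_assign; wsimp; rewrite rA2 rIE wkE; last lia.
  rewrite (tok u); do 2![split; first lia].
  apply: wp_seq; apply: wp_assign; wsimp; rewrite rN2 rIE; split; first lia.
  apply: wp_seq; apply: wp_assign; wsimp; rewrite rN2 wkQ -/p; do 2![split; first lia].
  apply: wp_seq; apply: wp_assign; wsimp; rewrite subn1 wkX; do 3![split; first lia].
  apply: wp_seq; apply: wp_store; wsimp; split; first lia.
  apply: wp_seq; apply: wp_store; wsimp; rewrite rN2; do 2![split; first lia].
  apply: wp_seq; apply: wp_assign; wsimp; rewrite rRE.
  do 2![split; first by []].
  apply: wp_assign; wsimp; rewrite rIE; do 3![split; first lia].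
  split; wsimp => //; first exact: addn1.
  + by move=> r' lt_r; rewrite !setr_lt ?fr // (leq_trans lt_r).
  + have nE : (n - i).-1 = n - i.+1 by lia.
    have okS := rankable_step ok; rewrite nE in okS *.
    exists (update av p (av (n - i.+1))), (update pos (av (n - i.+1)) p),
      (r * (n - i) + p).
    split=> //.
    * by rewrite -rankE /= nE.
    * apply: leq_trans le_r; rewrite (@fact_pred (n - i)) ?nE ?mulnA; last lia.
      by rewrite leq_mul2r mulSn; apply/orP; right; lia.
    * move=> x lt_xn; have [lt_ax wkx wknx] := arr x lt_xn; rewrite nE in lt_x.
      rewrite /update eqn_add2l; split.
      - by case: eqP.
      - by rewrite (ltn_eqF (m := x)) ?wkx //; lia.
      - by rewrite (gtn_eqF (m := p)) ?wknx //; lia.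
  + by split=> // x le_x; rewrite /update !gtn_eqF ?wkE //; lia.
- move=> st2 [_ rIE fr _ _]; wsimp; rewrite rIE fr // rNE ltnn; split=> //; lia.
- split=> //.
  + by move=> r lt_r; wsimp; rewrite !setr_lt ?fr1 // (leq_trans lt_r).
  + exists id, id, 0; rewrite subn0 drop0 mul1n; split=> //.
      exact: rankable_tokens.
    by move=> x lt_x; have [] := arr1 x lt_x.
move=> t st2 le_t [_ _ fr [av [pos [r [_ rankE _ rRE _]]]] [wkE outE]].
rewrite subnn drop_oversize ?size_tokens // in rankE.
split=> //; first by move: le_t; wsimp; lia.
by rewrite rRE -rankE.
Qed.

(** The node [x] is separate from [Q] because a candidate occupies slot [size Q] before it is
    inserted. The root has no parent, hence the condition on i. A parent index below i keeps the
    link valid when the queue grows. *)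
Definition stored (Q : seq node) i (x : node) (wk : nat -> nat) : Prop :=
  (forall v : 'I_n, wk (slot i + v) = x.1 v) /\
  (0 < i -> exists p (uv : 'I_n * 'I_n), [/\ p < i, x.2 = uv :: path Q p,
     wk (slot i + n) = p, wk (slot i + n + 1) = uv.1 & wk (slot i + n + 2) = uv.2]).

Definition queue_at (Q : seq node) (wk : nat -> nat) : Prop :=
  (forall i, i < size Q -> stored Q i (nth (bfs_root I) Q i) wk) /\
  (forall r, r < n`! ->
     wk (slot r + n + 3) = (r \in [seq config_rank x.1 | x <- Q]) :> nat).

Lemma stored_work Q i x wk wk' :
  (forall y, y < n + 3 -> wk' (slot i + y) = wk (slot i + y)) ->
  stored Q i x wk -> stored Q i x wk'.
Proof.
move=> eq_wk [tok link]; split=> [v|i_gt0].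
  by rewrite eq_wk ?tok // ltn_addr.
have [p [uv [lt_p xE wp_ wu wv]]] := link i_gt0; exists p, uv.
split=> //; first by rewrite eq_wk //; lia.
  by rewrite -addnA eq_wk ?addnA // ltn_add2l.
by rewrite -addnA eq_wk ?addnA // ltn_add2l.
Qed.

Lemma stored_queue Q Q' i x wk : i <= size Q -> extends Q Q' ->
  stored Q i x wk -> stored Q' i x wk.
Proof.
move=> le_i [_ eqQ] [tok link]; split=> // i_gt0.
have [p [uv [lt_p xE wp_ wu wv]]] := link i_gt0; exists p, uv.
by split=> //; rewrite eqQ // (leq_trans lt_p).
Qed.

Lemma insertP Q x st : regs st rN = n -> regs st rT = size Q -> size Q <= n`! ->
  queue_at Q (work st) -> stored Q (size Q) x (work st) ->
  wp insert st (fun t st' => [/\ t <= 80 * n + 80,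
    forall r, r < 7 -> r != rT -> regs st' r = regs st r,
    regs st' rT = size (insert_node Q x),
    queue_at (insert_node Q x) (work st') & output st' = output st]).
Proof.
move=> rNE rTE le_sz [stQ visQ] stx; have szE := size_encode adj.
have n_gt0 := num_vertices_gt0 I; have [tok _] := stx.
have lt_rk := config_rank_lt x.1.
have lt_slotQ := slot_lt_n3 le_sz; have lt_fact := fact_lt_space.
have lt_slotr := slot_lt_n3 (ltnW lt_rk).
apply: wp_seq; apply: (wp_slot rNE rTE) => //.
apply: wp_seq.
apply: (wp_mono (rank_slotP (c := x.1) (a := slot (size Q)) _ _ (slot_ge _) _ _)) => //.
  by lia.
move=> t1 st1 [le_t1 fr rRE wkE outE].
have rN1 : regs st1 rN = n by rewrite fr.
have rT1 : regs st1 rT = size Q by rewrite fr.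
have wk_slot i y : work st1 (slot i + y) = work st (slot i + y).
  by rewrite wkE // (leq_trans (slot_ge i)) ?leq_addr.
have stx1 : stored Q (size Q) x (work st1) by apply: stored_work stx.
have qat1 : queue_at Q (work st1).
  split=> [i lt_i|r lt_r]; last by rewrite -addnA wk_slot addnA visQ.
  by apply: stored_work (stQ i lt_i).
apply: wp_seq; apply: (wp_slot rN1 rRE); first exact: ltnW.
apply: wp_if; wsimp; rewrite rN1.
have visE := qat1.2 _ lt_rk.
rewrite (_ : _ \in _ = (x.1 \in [seq y.1 | y <- Q])) in visE; last first.
  by rewrite (map_comp (@config_rank I) fst) mem_map //; apply: config_rank_inj.
rewrite visE; do 4![split; first lia].
rewrite /insert_node; apply: bool_cases => x_Q.
  rewrite x_Q; apply: wp_skip; split=> //; first lia.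
  by move=> r lt_r _; have lt_r8 := ltnW lt_r; rewrite /= setr_lt // fr //= setr_lt.
rewrite (negPf x_Q); apply: wp_seq; apply: wp_store; wsimp; rewrite rN1.
do 5![split; first lia].
apply: wp_assign; wsimp; rewrite rT1; do 2![split; first lia]; split; wsimp => //.
- by lia.
- move=> r lt_r neq_r; rewrite (setr_neq _ _ neq_r).
  by have lt_r8 := ltnW lt_r; rewrite setr_lt // fr //= setr_lt.
- by rewrite size_rcons addn1.
split=> [i|r lt_r].
  rewrite size_rcons ltnS leq_eqVlt => le_i.
  have st_i : stored Q i (nth (bfs_root I) (rcons Q x) i) (work st1).
    rewrite nth_rcons; case/orP: le_i => [/eqP->|lt_i]; first by rewrite ltnn eqxx.
    by rewrite lt_i; apply: qat1.1.
  apply: (stored_queue (Q := Q)).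
  - by case/orP: le_i => [/eqP->|/ltnW].
  - by have := extends_insert Q x; rewrite /insert_node (negPf x_Q).
  apply: stored_work st_i => y lt_y; rewrite /update -addnA.
  have [ir|neq_ir] := eqVneq i (config_rank x.1); last first.
    by rewrite (negPf (slot_neq neq_ir _ _)) //; lia.
  by rewrite ir eqn_add2l ltn_eqF.
rewrite map_rcons mem_rcons inE /update -!(addnA (slot _)).
have [->|neq_r] := eqVneq r (config_rank x.1); first by rewrite eqxx.
rewrite (negPf (slot_neq neq_r _ _)) /=; [|lia..].
by rewrite addnA qat1.2.
Qed.

Lemma copy_swappedP Q h (uv : 'I_n * 'I_n) st : regs st rN = n ->
  regs st rT = size Q -> regs st rH = h -> regs st rU = uv.1 -> regs st rV = uv.2 ->
  size Q <= n`! -> h < size Q -> uv.1 != uv.2 -> queue_at Q (work st) ->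
  wp copy_swapped st (fun t st' => [/\ t <= 20 * n + 70,
    forall r, r < 7 -> regs st' r = regs st r,
    queue_at Q (work st'),
    stored Q (size Q) (swap (conf Q h) uv, uv :: path Q h) (work st') &
    output st' = output st]).
Proof.
move=> rNE rTE rHE rUE rVE le_sz lt_h neq_uv qat; have szE := size_encode adj.
have lt_slotQ := slot_lt_n3 le_sz.
have lt_sloth := slot_lt_n3 (ltnW (leq_trans lt_h le_sz)).
have lt_u := ltn_ord uv.1; have lt_v := ltn_ord uv.2; have lt_fact := fact_lt_space.
have [[tok_h _] neq_h] := (qat.1 h lt_h, ltn_eqF lt_h).
have neq_slot x y : x < n -> y < n -> slot h + x != slot (size Q) + y.
  by move=> lt_x lt_y; apply: slot_neq; rewrite ?neq_h //; lia.
set T := slot (size Q) in lt_slotQ neq_slot *.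
set H := slot h in tok_h lt_sloth neq_slot.
apply: wp_seq; apply: (wp_slot rNE rTE le_sz).
apply: wp_seq; apply: (wp_slot (i := h)) => //.
  exact: ltnW (leq_trans lt_h le_sz).
apply: wp_seq; apply: wp_assign; wsimp; split; first lia.
apply: wp_seq; rewrite -/T -/H.
pose J i st' := [/\ i <= n, regs st' rI = i,
  [/\ forall r, r < 7 -> regs st' r = regs st r, regs st' rA = T & regs st' rB = H],
  (forall x, x < i -> work st' (T + x) = work st (H + x)) /\
  (forall y, ~~ (T <= y < T + n) -> work st' y = work st y) &
  output st' = output st].
apply: (@wp_for _ _ _ J n 15).
- move=> i st1 [le_in rIE [fr rAE rBE] [copied wkE] outE] lt_in; wsimp.
  have rN1 : regs st1 rN = n by rewrite fr.
  rewrite rIE rN1 lt_in; split; first by split; lia.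
  apply: wp_seq; apply: wp_store; wsimp; rewrite rAE rBE rIE.
  do 4![split; first lia].
  apply: wp_assign; wsimp; rewrite rIE; do 3![split; first lia].
  split; wsimp => //.
  + exact: addn1.
  + split; wsimp => //.
    by move=> r lt_r; rewrite setr_lt ?fr // (leq_trans lt_r).
  (* The source cell has not been overwritten: otherwise it would belong to two different slots. *)
  + have wkH : work st1 (H + i) = work st (H + i).
      apply: wkE; apply/negP => /andP[le_T lt_T].
      have := neq_slot i (H + i - T) lt_in; rewrite subnKC // eqxx => F.
      by have := F ltac:(lia).
    split=> [x|y out_y]; last first.
      by rewrite /update ifN ?wkE //; apply: contraNneq out_y => ->; lia.
    rewrite ltnS leq_eqVlt /update eqn_add2l => /orP[/eqP->|lt_x].
      by rewrite eqxx.
    by rewrite ltn_eqF ?copied.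
- move=> st1 [_ rIE [fr _ _] _ _]; wsimp; rewrite rIE fr // rNE ltnn; split=> //; lia.
- split=> //; split; wsimp => //.
  by move=> r lt_r; rewrite !setr_lt // (leq_trans lt_r).
move=> t1 st1 le_t1 [_ _ [fr rAE rBE] [copied wkE] outE]; move: le_t1; wsimp => le_t1.
have wkH (v : 'I_n) : work st1 (H + v) = conf Q h v.
  rewrite wkE ?tok_h //; apply/negP => /andP[le_T lt_T].
  have := neq_slot v (H + v - T) (ltn_ord v); rewrite subnKC // eqxx => F.
  by have := F ltac:(lia).
have rN1 : regs st1 rN = n by rewrite fr.
have rH1 : regs st1 rH = h by rewrite fr.
have rU1 : regs st1 rU = uv.1 by rewrite fr.
have rV1 : regs st1 rV = uv.2 by rewrite fr.
apply: wp_seq; apply: wp_store; wsimp; rewrite rAE rBE rU1 rV1; do 4![split; first lia].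
apply: wp_seq; apply: wp_store; wsimp; rewrite rAE rBE rU1 rV1; do 4![split; first lia].
apply: wp_seq; apply: wp_store; wsimp; rewrite rAE rN1 rH1; do 2![split; first lia].
apply: wp_seq; apply: wp_store; wsimp; rewrite rAE rN1 rU1; do 4![split; first lia].
apply: wp_store; wsimp; rewrite rAE rN1 rV1; do 4![split; first lia].
rewrite [update (work st1) _ _ (H + uv.1)]/update (negPf (neq_slot _ _ _ _)) // !wkH.
set wk := update _ _ _; have wk_out y : ~~ (T <= y < T + (n + 3)) -> wk y = work st y.
  move=> out_y; rewrite /wk /update; do 5![case: eqP => [?|_]; first lia].
  by rewrite wkE //; lia.
have wk_slot i y : i != size Q -> y < n + 4 -> wk (slot i + y) = work st (slot i + y).
  move=> neq_i lt_y; apply: wk_out; apply/negP => /andP[le_T lt_T].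
  have := slot_neq neq_i lt_y (_ : slot i + y - T < n + 4); rewrite -/T subnKC // eqxx.
  by move=> F; have := F ltac:(lia).
split=> //; first lia.
- split=> [i lt_i|r lt_r].
    apply: stored_work (qat.1 i lt_i) => y lt_y.
    by rewrite wk_slot ?(ltn_eqF lt_i) //; lia.
  rewrite -qat.2 //; have [->|neq_r] := eqVneq r (size Q).
    by apply: wk_out; rewrite -/T; lia.
  by rewrite -!(addnA (slot _)) wk_slot //; lia.
split=> [x|_].
  have lt_x := ltn_ord x; rewrite -/T /wk /update !eqn_add2l.
  do 3![case: eqP => [?|_]; first lia].
  rewrite /swap permM; have -> : (x == uv.2 :> nat) = (x == uv.2) by [].
  have -> : (x == uv.1 :> nat) = (x == uv.1) by [].
  case: tpermP => [->|->|/eqP/negPf-> /eqP/negPf->]; rewrite ?eqxx ?(negPf neq_uv) //.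
  by rewrite copied ?tok_h.
exists h, uv; rewrite -/T /wk /update; split=> //.
- by do 2![case: eqP => [?|_]; first lia]; rewrite eqxx.
- by do 1![case: eqP => [?|_]; first lia]; rewrite eqxx.
- by rewrite eqxx.
Qed.

Lemma compareP Q h st : regs st rN = n -> regs st rH = h -> size Q <= n`! ->
  h < size Q -> queue_at Q (work st) ->
  wp compare st (fun t st' => [/\ t <= 25 * n + 30,
    forall r, r < 6 -> regs st' r = regs st r,
    regs st' rG = (conf Q h != initial I) :> nat,
    work st' = work st & output st' = output st]).
Proof.
move=> rNE rHE le_sz lt_h qat; have szE := size_encode adj.
have lt_sloth := slot_lt_n3 (ltnW (leq_trans lt_h le_sz)).
have [tok _] := qat.1 h lt_h; set c := conf Q h in tok *.
apply: wp_seq; apply: wp_assign; wsimp; split; first lia.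
apply: wp_seq; apply: (wp_slot (i := h)) => //.
  exact: ltnW (leq_trans lt_h le_sz).
apply: wp_seq; apply: wp_assign; wsimp; split; first lia.
set H := slot h in tok lt_sloth *.
pose J i st' := [/\ i <= n, regs st' rI = i,
  (forall r, r < 6 -> regs st' r = regs st r) /\ regs st' rB = H,
  regs st' rG = ~~ [forall v : 'I_n, (v < i) ==> (c v == initial I v)] :> nat &
  work st' = work st /\ output st' = output st].
apply: (@wp_for _ _ _ J n 20).
- move=> i st1 [le_in rIE [fr rBE] rGE [wkE outE]] lt_in; wsimp.
  have rN1 : regs st1 rN = n by rewrite fr.
  rewrite rIE rN1 lt_in; split; first by split; lia.
  pose u := Ordinal lt_in; have lt_c := ltn_ord (c u).
  have tokE : nth 0 inp (1 + i) = initial I u by rewrite -(nth_encode_token adj).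
  have allE : [forall v : 'I_n, (v < i.+1) ==> (c v == initial I v)] =
      [forall v : 'I_n, (v < i) ==> (c v == initial I v)] && (c u == initial I u).
    apply/forallP/andP => [all_i|[/forallP all_i eq_u] v].
      split; last by have := all_i u; rewrite /= ltnSn.
      by apply/forallP => v; apply/implyP => lt_v; have := all_i v; rewrite ltnS ltnW.
    rewrite ltnS leq_eqVlt; apply/implyP => /orP[/eqP vu|lt_v].
      by have -> : v = u by exact: val_inj.
    by have := all_i v; rewrite lt_v.
  have cuE : (c u == initial I u :> nat) = (c u == initial I u) by [].
  apply: wp_seq; apply: wp_if; wsimp; rewrite rBE rIE wkE (tok u) tokE cuE.
  do 5![split; first lia]; split; first by case: (_ == _); lia.
  apply: bool_cases => eq_u.
    apply: wp_skip; apply: wp_assign; wsimp; rewrite rIE; do 3![split; first lia].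
    split; wsimp => //; rewrite ?addn1 // ?allE ?eq_u ?andbT //.
    by split=> // r lt_r; rewrite setr_lt ?fr // (leq_trans lt_r).
  apply: wp_assign; wsimp; split; first lia.
  apply: wp_assign; wsimp; rewrite rIE; do 3![split; first lia].
  split; wsimp => //; rewrite ?addn1 // ?allE ?(negPf eq_u) ?andbF //.
  by split=> // r lt_r; rewrite !setr_lt ?fr // (leq_trans lt_r).
- move=> st1 [_ rIE [fr _] _ _]; wsimp; rewrite rIE fr // rNE ltnn; split=> //; lia.
- split=> //; wsimp.
    by split=> // r lt_r; rewrite !setr_lt // (leq_trans lt_r).
  by have -> : [forall v : 'I_n, (v < 0) ==> (c v == initial I v)] by apply/forallP.
- move=> t st1 le_t [_ _ [fr _] rGE [wkE outE]]; split=> //.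
    by move: le_t; wsimp; lia.
  rewrite rGE; congr (nat_of_bool (~~ _)).
  apply/forallP/eqP => [all_v|-> v]; last by rewrite eqxx implybT.
  by apply/permP => v; have := all_v v; rewrite ltn_ord => /eqP.
Qed.

Lemma expandP Q h st : regs st rN = n -> regs st rT = size Q -> regs st rH = h ->
  bfs_queue Q h -> h < size Q -> queue_at Q (work st) ->
  wp expand st (fun t st' => [/\ t <= (n + size arcs) * (100 * n + 200) + 10,
    regs st' rN = n /\ regs st' rH = h, output st' = output st &
    exists Q', [/\ extends Q Q', bfs_queue Q' h, expanded Q' h,
      regs st' rT = size Q' & queue_at Q' (work st')]]).
Proof.
move=> rNE rTE rHE okQ lt_h qat; have szE := size_encode adj.
do 2![apply: wp_seq; apply: wp_assign; wsimp; split; first lia].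
pose arc p := nth (v0, v0) arcs p.
pose done Q' p := forall q, q < p -> (arc q).1 < (arc q).2 ->
  reached Q' (swap (conf Q h) (arc q)) (size (path Q h)).+1.
pose J i st' := exists u p Q', [/\ [/\ i = (n - u) + (size arcs - p),
    u <= n & offset adj u <= p <= offset adj u.+1],
  [/\ regs st' rN = n, regs st' rH = h, regs st' rU = u & regs st' rP = p],
  [/\ extends Q Q', bfs_queue Q' h & done Q' p],
  regs st' rT = size Q' /\ queue_at Q' (work st') & output st' = output st].
pose R st' := [/\ regs st' rN = n /\ regs st' rH = h, output st' = output st &
    exists Q', [/\ extends Q Q', bfs_queue Q' h, expanded Q' h,
      regs st' rT = size Q' & queue_at Q' (work st')]].
apply: (@wp_while _ _ _ J R (100 * n + 190) (n + size arcs)).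
- move=> i st1 [u [p [Q' [[iE le_u p_bnd] [rN1 rH1 rU1 rP1]
    [ext okQ' doneQ'] [rT1 qat1] outE]]]].
  wsimp; rewrite rU1 rN1; split; first by case: (u < n); lia.
  have off_size := offset_le_size adj u.+1.
  have [lt_un|ge_un] := ltnP u n; split=> //; last first.
    move=> _; have eq_un : u = n by lia.
    split=> //; exists Q'; split=> //; have [_ eqQ] := ext.
    have doneE uv : adjacent uv.1 uv.2 -> uv.1 < uv.2 ->
        reached Q' (swap (conf Q h) uv) (size (path Q h)).+1.
      move=> adj_uv lt_uv; have uv_arc : uv \in arcs by rewrite (mem_arcs adjP).
      have arcE : arc (index uv arcs) = uv by exact: nth_index.
      rewrite -arcE; apply: doneQ'; rewrite ?arcE //.
      apply: leq_trans (_ : size arcs <= p); first by rewrite index_mem.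
      by rewrite -offset_size -eq_un; case/andP: p_bnd.
    move=> uv adj_uv; rewrite eqQ //.
    (* The program tries increasing arcs only; the other direction is the same swap. *)
    have [lt_uv|lt_vu|/val_inj eq_uv] := ltngtP uv.1 uv.2; first exact: doneE.
      rewrite (surjective_pairing uv) swap_sym; apply: doneE => //=.
      by rewrite adjacent_sym.
    by rewrite eq_uv adjacent_irr in adj_uv.
  move=> _; pose u' := Ordinal lt_un.
  have offE := nth_encode_offset adj lt_un.
  have addrE : n + u + 2 = n + 1 + u.+1 by lia.
  have le_sz' := size_bfs_queue okQ'.
  have lt_h' : h < size Q' by case: ext => le_sz _; apply: leq_trans le_sz.
  have next_u : offset adj u.+1 <= p -> J ((n - u.+1) + (size arcs - p))
      (State (setr (regs st1) rU (u + 1)) (work st1) (output st1)).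
    move=> ge_p; exists u.+1, p, Q'; split=> //; last by split; wsimp; rewrite ?addn1.
    split=> //; have -> : p = offset adj u.+1 by lia.
    by rewrite leqnn offset_le.
  have [lt_p|ge_p] := ltnP p (offset adj u.+1); last first.
    exists ((n - u.+1) + (size arcs - p)); first lia.
    apply: wp_if; wsimp.
    rewrite rP1 rN1 rU1 addrE offE (ltnNge p) ge_p [~~ true : nat]/=.
    do 5![split; first lia]; split=> // _.
    apply: wp_assign; wsimp; rewrite rU1; do 3![split; first lia].
    exact: next_u.
  have lt_pa : p < size arcs by exact: leq_trans lt_p _.
  exists ((n - u) + (size arcs - p.+1)); first lia.
  apply: wp_if; wsimp; rewrite rP1 rN1 rU1 addrE offE lt_p.
  do 4![split; first lia]; split; first lia; split=> // _.
  have arc1 : (arc p).1 = u'.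
    by apply: nth_arcs; case/andP: p_bnd => -> _.
  set v := (arc p).2; have lt_v := ltn_ord v.
  have vE : nth 0 inp (n + n + 2 + p) = v.
    by rewrite (_ : n + n = 2 * n) ?(nth_encode_arc (v0, v0)) //; lia.
  apply: wp_seq; apply: wp_assign; wsimp; rewrite rN1 rP1 vE; do 5![split; first lia].
  have next_p Q2 st2 : extends Q' Q2 -> bfs_queue Q2 h -> 
      ((arc p).1 < (arc p).2 ->
        reached Q2 (swap (conf Q h) (arc p)) (size (path Q h)).+1) ->
      regs st2 rN = n -> regs st2 rH = h -> regs st2 rU = u -> regs st2 rP = p.+1 ->
      regs st2 rT = size Q2 -> queue_at Q2 (work st2) -> output st2 = output st ->
      J (n - u + (size arcs - p.+1)) st2.
    move=> ext2 okQ2 reach e1 e2 e3 e4 e5 e6 e7; exists u, p.+1, Q2; split=> //.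
      by split=> //; case/andP: p_bnd => le_p _; rewrite leqW.
    split=> //; first exact: extends_trans ext2.
    move=> q; rewrite ltnS leq_eqVlt => /orP[/eqP->|lt_q] // lt_uv.
    by apply: extends_reached ext2 _; apply: doneQ'.
  apply: wp_seq; apply: wp_if; wsimp; rewrite rU1; split; first by case: (u < v); lia.
  apply: bool_cases => [lt_uv|Nlt_uv]; last first.
    apply: wp_skip; apply: wp_assign; wsimp; rewrite rP1; do 3![split; first lia].
    apply: (next_p Q') => //; wsimp; rewrite ?addn1 //.
    by rewrite arc1 -/v /= (negPf Nlt_uv).
  have adj_p : adjacent (arc p).1 (arc p).2.
    by have := mem_arcs adjP (arc p); rewrite mem_nth.
  have [eqh] : nth (bfs_root I) Q' h = nth (bfs_root I) Q h by case: ext => _ ->.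
  set st2 := State _ _ _.
  apply: wp_seq.
  apply: (wp_mono (copy_swappedP (Q := Q') (h := h) (uv := arc p) (st := st2)
    _ _ _ _ _ le_sz' lt_h' _ qat1)); wsimp => //.
  - by rewrite arc1.
  - by rewrite arc1 -/v -val_eqE /= ltn_eqF.
  move=> t2 st3 [le_t2 fr3 qat3 st3x outE3].
  apply: (wp_mono (insertP _ _ le_sz' qat3 st3x)); rewrite ?fr3 //; wsimp => //.
  move=> t3 st4 [le_t3 fr4 rT4 qat4 outE4].
  have [okQ2 reach2] := bfs_insert okQ' lt_h' adj_p.
  have fr5 r : r < 7 -> r != rT -> regs st4 r = regs st2 r.
    by move=> lt_r neq_r; rewrite fr4 // fr3.
  have rP4 : regs st4 rP = p by rewrite fr5.
  apply: wp_assign; wsimp; rewrite rP4.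
  do 3![split; first lia].
  rewrite eqh in okQ2 reach2 rT4 qat4.
  apply: (next_p _ _ (extends_insert _ _) okQ2) => //; wsimp.
  + by rewrite fr5.
  + by rewrite fr5.
  + by rewrite fr5.
  + exact: addn1.
  + by rewrite outE4 outE3.
- by exists 0, 0, Q; split=> //; rewrite !subn0 offset0.
- move=> t st1 le_t [rs outE ex]; split=> //.
  move: le_t; wsimp; nia.
Qed.

(** Parents precede their children, so depth is at most the index. This bounds the time of the final
    emission in terms of n!. *)
Lemma size_path_leq Q wk i : 0 < size Q -> nth (bfs_root I) Q 0 = bfs_root I ->
  queue_at Q wk -> i < size Q -> size (path Q i) <= i.
Proof.
move=> Q_gt0 Q0 [stQ _]; elim/ltn_ind: i => i IHi lt_i.
have [->|i_gt0] := posnP i; first by rewrite Q0.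
have [_ /(_ i_gt0)[p [uv [lt_p -> _ _ _]]]] := stQ i lt_i.
by apply: leq_trans (lt_p); rewrite /= ltnS IHi // (ltn_trans lt_p).
Qed.

Lemma emit_pathP Q h st : regs st rN = n -> regs st rH = h -> size Q <= n`! ->
  h < size Q -> nth (bfs_root I) Q 0 = bfs_root I -> queue_at Q (work st) ->
  output st = [::] ->
  wp emit_path st (fun t st' => t <= 40 * h + 10 /\
    output st' = encode_swaps (path Q h)).
Proof.
move=> rNE rHE le_sz lt_h Q0 qat outE; have szE := size_encode adj.
have le_path : size (path Q h) <= h.
  by apply: (size_path_leq _ Q0 qat lt_h); apply: leq_trans lt_h.
pose J i st' := exists h', [/\ h' < size Q, i = size (path Q h'),
  regs st' rN = n /\ regs st' rH = h', work st' = work st &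
  output st' ++ encode_swaps (path Q h') = encode_swaps (path Q h)].
apply: (@wp_while _ _ _ J (fun st' => output st' = encode_swaps (path Q h)) 35
  (size (path Q h))).
- move=> i st1 [h' [lt_h' iE [rN1 rH1] wkE outE1]]; wsimp; rewrite rH1; split.
    by move=> h'0; move: outE1; rewrite h'0 Q0 /= cats0.
  move=> h'_gt0.
  have [_ /(_ h'_gt0)[p [uv [lt_p pathE wp_ wu wv]]]] := qat.1 h' lt_h'.
  exists (size (path Q p)); first by rewrite iE pathE.
  have lt_slot := slot_lt_n3 (ltnW (leq_trans lt_h' le_sz)).
  have lt_u := ltn_ord uv.1; have lt_v := ltn_ord uv.2.
  apply: wp_seq; apply: (wp_slot rN1 rH1); first exact: ltnW (leq_trans lt_h' le_sz).
  set H := slot h' in lt_slot wp_ wu wv *.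
  apply: wp_seq; apply: wp_emit; wsimp; rewrite rN1 ?wkE wu; do 4![split; first lia].
  apply: wp_seq; apply: wp_emit; wsimp; rewrite rN1 ?wkE wv; do 4![split; first lia].
  apply: wp_assign; wsimp; rewrite rN1 ?wkE wp_; do 2![split; first lia].
  split; first lia; exists p; split=> //; first exact: ltn_trans lt_h'.
  by rewrite -outE1 pathE /= -!cats1 -!catA.
- by exists h; split=> //; rewrite outE.
- by move=> t st1 le_t out1; split=> //; move: le_t; wsimp; nia.
Qed.

Lemma progP : wp prog start (fun t st' =>
  t <= n`! * ((n + size arcs) * (100 * n + 200) + 30 * n + 100) + 200 * n + 300 /\
  exists2 s : seq ('I_n * 'I_n), output st' = encode_swaps s & optimal s).
Proof.
have szE := size_encode adj; have n_gt0 := num_vertices_gt0 I.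
have lt_slot0 := slot_lt_n3 (leq0n n`!); have lt_fact := fact_lt_space.
have slot0 : slot 0 = 2 * n by rewrite /slot addn0.
apply: wp_seq; apply: wp_assign; wsimp; do 2![split; first lia].
apply: wp_seq; apply: wp_assign; wsimp; split; first lia.
apply: wp_seq.
pose J i st' := [/\ i <= n, regs st' rI = i, regs st' rN = n,
  (forall x, x < i -> work st' (slot 0 + x) = x) /\
  (forall y, ~~ (slot 0 <= y < slot 0 + n) -> work st' y = 0) & output st' = [::]].
apply: (@wp_for _ _ _ J n 20).
- move=> i st1 [le_in rIE rN1 [tok wk0] outE] lt_in; wsimp.
  rewrite rIE rN1 lt_in; split; first by split; lia.
  apply: wp_seq; apply: wp_store; wsimp; rewrite rIE rN1; do 3![split; first lia].
  apply: wp_assign; wsimp; rewrite rIE; do 3![split; first lia].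
  have -> : n + n + i = slot 0 + i by lia.
  split; wsimp => //; first exact: addn1.
  split=> [x|y out_y]; last first.
    by rewrite /update ifN ?wk0 //; apply: contraNneq out_y => ->; lia.
  rewrite ltnS leq_eqVlt /update eqn_add2l => /orP[/eqP->|lt_x].
    by rewrite eqxx.
  by rewrite ltn_eqF ?tok.
- by move=> st1 [_ rIE rN1 _ _]; wsimp; rewrite rIE rN1 ltnn; split=> //; lia.
- by split.
move=> t1 st1 le_t1 [_ _ rN1 [tok1 wk1] outE1]; move: le_t1; wsimp => le_t1.
apply: wp_seq; apply: wp_assign; wsimp; split; first lia.
apply: wp_seq.
apply: (wp_mono (insertP (Q := [::]) (x := bfs_root I) _ _ _ _ _)); wsimp => //.
(* Only the token cells of slot 0 have been written, so all flags still have their initial value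
   0. *)
- split=> // r lt_r; rewrite wk1 // -(addnA (slot r)).
  have [->|neq_r] := eqVneq r 0; first lia.
  apply/negP => /andP[le_s lt_s].
  have := slot_neq neq_r (_ : n + 3 < n + 4) (_ : slot r + (n + 3) - slot 0 < n + 4).
  by rewrite subnKC // eqxx => F; have := F ltac:(lia) ltac:(lia).
- by split=> // v; rewrite perm1 tok1.
move=> t2 st2 [le_t2 fr2 rT2 qat2 outE2].
apply: wp_seq; apply: wp_assign; wsimp; split; first lia.
apply: wp_seq.
apply: (wp_mono (compareP (Q := [:: bfs_root I]) (h := 0) _ _ (fact_gt0 n) _ _)) => //.
  by wsimp; rewrite fr2.
move=> t3 st3 [le_t3 fr3 rG3 wk3 outE3].
apply: wp_seq.
pose J2 i st' := exists Q h, [/\ i = n`! - h, bfs_inv Q h,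
  [/\ regs st' rN = n, regs st' rH = h, regs st' rT = size Q &
      regs st' rG = (conf Q h != initial I) :> nat],
  queue_at Q (work st') & output st' = [::]].
pose R2 st' := exists Q h, [/\ bfs_inv Q h, conf Q h = initial I,
  regs st' rN = n /\ regs st' rH = h, queue_at Q (work st') & output st' = [::]].
pose B := (n + size arcs) * (100 * n + 200) + 25 * n + 50.
apply: (@wp_while _ _ _ J2 R2 B n`!).
- move=> i st4 [Q [h [iE inv [rN4 rH4 rT4 rG4] qat4 outE4]]]; wsimp; rewrite rG4.
  have [okQ lt_h _] := inv; have le_sz := size_bfs_queue okQ.
  case: eqVneq => [eq_c|neq_c]; split=> // _; first by exists Q, h.
  (* The head is inside a queue of at most n! distinct configurations, so h < n!. *)
  exists (n`! - h.+1); first lia.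
  apply: wp_seq; apply: (wp_mono (expandP rN4 rT4 rH4 okQ lt_h qat4)).
  move=> t5 st5 [le_t5 [rN5 rH5] outE5 [Q' [ext okQ' expQ' rT5 qat5]]].
  have inv' := bfs_next inv neq_c ext okQ' expQ'.
  have [_ lt_h' _] := inv'; have le_sz' := size_bfs_queue okQ'.
  apply: wp_seq; apply: wp_assign; wsimp; rewrite rH5; do 2![split; first lia].
  apply: (wp_mono (compareP (Q := Q') (h := h.+1) _ _ le_sz' lt_h' _)); wsimp => //.
    exact: addn1.
  move=> t6 st6 [le_t6 fr6 rG6 wk6 outE6]; split; first by rewrite /B; lia.
  exists Q', h.+1; split=> //.
  + by split=> //; rewrite fr6 //; exact: addn1.
  + by rewrite wk6.
  + by rewrite outE6 outE5.
- exists [:: bfs_root I], 0; split=> //.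
  + by rewrite subn0.
  + exact: bfs_init.
  + by split=> //; rewrite fr3 //; wsimp; rewrite fr2.
  + by rewrite wk3.
  + by rewrite outE3 outE2.
move=> t4 st4 le_t4 [Q [h [inv eq_c [rN4 rH4] qat4 outE4]]].
have [okQ lt_h _] := inv; have le_sz := size_bfs_queue okQ.
have Q0 : nth (bfs_root I) Q 0 = bfs_root I by case: okQ => [[]].
apply: (wp_mono (emit_pathP rN4 rH4 le_sz lt_h Q0 qat4 outE4)).
move=> t5 st5 [le_t5 outE5]; split; last first.
  by exists (path Q h) => //; apply: bfs_optimal eq_c.
move: le_t4; wsimp; rewrite /B; nia.
Qed.

End Correctness.
End Bfs.

(** * Cost of the breadth-first search, and the coarser forms of the bounds *)

Lemma factorial_within :
  optimal_swaps_found_within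
    (fun I => (num_vertices I)`! * num_edges I * num_vertices I * log2 (num_vertices I))
    (fun I => (num_vertices I)`! * num_edges I * num_vertices I * log2 (num_vertices I) %/
              (num_vertices I * log2 (num_vertices I))).
Proof.
have [c le_c] : exists c, 200 * 100 <= c by exists (200 * 100).
apply: (@found_withinI _ _ Bfs.prog c); first lia.
move=> I adj adjP cells W leW; set n := num_vertices I; set m := num_edges I.
have n_gt0 : 0 < n := num_vertices_gt0 I; have F_gt0 := fact_gt0 n.
have le_arcs : size (arcs adj) <= 2 * m := size_arcs_leq adjP.
(* For a single vertex the bound itself is 0 and [maxn 1] leaves a constant, so this case is
   computed separately. *)
have [n_gt1|n_le1] := ltnP 1 n; last first.
  have n1 : n = 1 by lia.
  have le_space : Bfs.slot I (num_vertices I)`!.+1 <= cells.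
    rewrite /Bfs.slot -/n n1 (_ : 1`! = 1) //; apply: (@leq_trans c); first lia.
    by rewrite leq_pmulr // leq_maxl.
  apply: (wp_mono (Bfs.progP adjP leW le_space)) => t st [le_t ?].
  have arcs0 : size (arcs adj) = 0 by rewrite (arcs_nil adjP).
  rewrite arcs0 -/n n1 (_ : 1`! = 1) // in le_t.
  split=> //; apply: leq_trans le_t _; apply: (@leq_trans c); first lia.
  by rewrite leq_pmulr // leq_maxl.
have m_gt0 : 0 < m := num_edges_gt0 adjP n_gt1.
have le_n : n <= 2 * m by exact: leq_trans (leq_vertices_arcs adjP n_gt1) le_arcs.
have cellsE : cells = c * (n`! * m).
  by rewrite /cells divn_nlogn // (maxn_idPr _) // muln_gt0 F_gt0.
have le_F : n <= n * n`! by rewrite leq_pmulr.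
have le_space : Bfs.slot I (num_vertices I)`!.+1 <= cells.
  rewrite /Bfs.slot -/n cellsE.
  apply: (@leq_trans (20 * (n`! * m))); last first.
    by rewrite leq_mul2r; apply/orP; right; lia.
  have : n`! * n <= n`! * (2 * m) by rewrite leq_mul2l le_n orbT.
  have : 2 * n`! <= n`! * n by rewrite mulnC leq_mul2l n_gt1 orbT.
  nia.
apply: (wp_mono (Bfs.progP adjP leW le_space)) => t st [+ ?]; rewrite -/n => le_t.
split=> //; apply: leq_trans le_t _.
have L_gt0 := log2_gt0 n_gt1.
rewrite (maxn_idPr _) ?muln_gt0 ?F_gt0 ?m_gt0 ?n_gt0 //.
apply: (@leq_trans (c * (n`! * m * n))); last first.
  by rewrite leq_mul2l leq_pmulr ?orbT.
apply: (@leq_trans (200 * 100 * (n`! * m * n))); last by rewrite leq_mul2r le_c orbT.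
have le_mn : n <= m * n by rewrite leq_pmull.
have le_Fmn : m * n <= n`! * m * n by rewrite -mulnA leq_pmull.
have le1 : (n + size (arcs adj)) * (100 * n + 200) <= 4 * m * (200 * n).
  by apply: leq_mul; lia.
(* The constant 880 is 800 from [le1], 30 from 30n <= 30mn and 50 from 100 <= 50n <= 50mn. *)
have le2 : n`! * ((n + size (arcs adj)) * (100 * n + 200) + 30 * n + 100) <=
    n`! * (880 * (m * n)) by rewrite leq_mul2l; apply/orP; right; lia.
rewrite (mulnCA n`! 880) (mulnA n`!) in le2.
apply: leq_trans (leq_add (leq_add le2 (leqnn _)) (leqnn _)) _; lia.
Qed.

(** [log2] rounds down; the factor 2 makes up for this because [log2] n is at least 1. *)
Lemma log2_bound n : 1 < n -> n <= 2 ^ (2 * log2 n) /\ log2 n < n.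
Proof.
move=> n_gt1; have L_gt0 := log2_gt0 n_gt1.
have lt_n : n < 2 ^ (log2 n).+1 by exact: trunc_log_ltn.
split; first by apply: leq_trans (ltnW lt_n) _; rewrite leq_pexp2l //; lia.
apply: leq_trans (ltn_expl (log2 n) (isT : 1 < 2)) _.
by apply: trunc_logP => //; lia.
Qed.

Lemma num_edges_leq I : num_edges I <= num_vertices I ^ 2.
Proof. by apply: leq_trans (max_card _) _; rewrite card_prod card_ord. Qed.

Lemma fact_leq_expn n : n`! <= n ^ n.
Proof.
case: n => // n; apply: leq_trans (fact_leq_exp (ltnSn n)) _.
by rewrite leq_pexp2l.
Qed.

Lemma factorial_time_exponential c : exists c', forall I,
  c * ((num_vertices I)`! * num_edges I * num_vertices I * log2 (num_vertices I)) <=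
  2 ^ (c' * (num_vertices I * log2 (num_vertices I))).
Proof.
(* The exponent c absorbs the constant factor, as c <= 2^c. The 8 covers n^(n + 4), as 2(n + 4) <=
   8n for n >= 2. *)
exists (c + 8) => I; set n := num_vertices I; set L := log2 n.
have [n_gt1|n_le1] := ltnP 1 n; last first.
  have n1 : n = 1 by apply/eqP; rewrite eqn_leq n_le1 num_vertices_gt0.
  have -> : L = 0 by rewrite /L n1.
  by rewrite !muln0.
have [le_n /ltnW le_L] := log2_bound n_gt1; have L_gt0 := log2_gt0 n_gt1.
have le1 : n`! * num_edges I * n * L <= n ^ (n + 4).
  rewrite expnD -!mulnA leq_mul ?fact_leq_expn // (expnD n 2 2).
  by rewrite leq_mul ?num_edges_leq // -mulnn leq_mul.
have le2 : n ^ (n + 4) <= 2 ^ (8 * (n * L)).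
  apply: leq_trans (_ : _ <= (2 ^ (2 * L)) ^ (n + 4)) _.
    by rewrite leq_exp2r //; lia.
  rewrite -expnM leq_pexp2l //.
  have : L * 2 <= L * n by rewrite leq_mul2l n_gt1 orbT.
  nia.
have le3 : c <= 2 ^ (c * (n * L)).
  apply: leq_trans (ltnW (ltn_expl c (isT : 1 < 2))) _.
  by rewrite leq_pexp2l // leq_pmulr // muln_gt0 ltnW.
rewrite mulnDl expnD; apply: leq_mul => //; exact: leq_trans le2.
Qed.

Lemma edges_time_polynomial c : exists c', forall I,
  c * (num_edges I ^ min_swaps I * num_vertices I * log2 (num_vertices I)) <=
  c' * (num_vertices I ^ (2 * min_swaps I + 1) * log2 (num_vertices I)).
Proof.
exists c => I; rewrite leq_mul2l; apply/orP; right.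
rewrite expnD expn1 expnM leq_mul // leq_mul //.
have [->|k_gt0] := posnP (min_swaps I); first by [].
by rewrite leq_exp2r // num_edges_leq.
Qed.

Theorem theorem1 :
  let n := num_vertices in
  let m := num_edges in
  let k := min_swaps in
  let Delta := max_degree in
  let nlogn I := n I * log2 (n I) in
  let time1 I := (n I)`! * m I * n I * log2 (n I) in
  let time2 I := m I ^ k I * n I * log2 (n I) in
  let time3 I := (2 * k I * Delta I) ^ k I * (n I * log2 (n I)) in
  [/\ optimal_swaps_found_within time1 (fun I => time1 I %/ nlogn I) /\
        (forall c, exists c', forall I, c * time1 I <= 2 ^ (c' * nlogn I)),
      optimal_swaps_found_within time2 (fun I => time2 I %/ nlogn I) /\
        (forall c, exists c', forall I,
           c * time2 I <= c' * (n I ^ (2 * k I + 1) * log2 (n I))) &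
      optimal_swaps_found_within time3 (fun I => time3 I %/ nlogn I)].
Proof.
split; last exact: degree_within.
- by split; [apply: factorial_within | apply: factorial_time_exponential].
- by split; [apply: edges_within | apply: edges_time_polynomial].
Qed.
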